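(* Let $V=\{v_1,\dots,v_n\}\subset\mathbb{Z}^d$ be a coloop-free set of vectors spanning $\mathbb{R}^d$, let $Z=\{\sum_{i=1}^n\lambda_iv_i:0\le\lambda_i\le1\}$ be the zonotope it generates, and let $\varphi$ be a combinatorially positive $\mathbb{Z}^d$-valuation. Then $h^\varphi(Z)(t)=h_0+\cdots+h_dt^d$ is alternatingly increasing, i.e. $h_0\le h_d\le h_1\le h_{d-1}\le\cdots\le h_{\lfloor\frac{d+1}{2}\rfloor}$.
   Context: $V$ is coloop free if no $v_i$ is contained in every maximal linearly independent subset of $V$. A $\mathbb{Z}^d$-valuation is a map $\varphi$ from lattice polytopes in $\mathbb{R}^d$ (including $\emptyset$) to an abelian group $G$ with $\varphi(\emptyset)=0$, $\varphi(P\cup Q)=\varphi(P)+\varphi(Q)-\varphi(P\cap Q)$ whenever $P,Q,P\cup Q,P\cap Q$ are lattice polytopes, and $\varphi(P+x)=\varphi(P)$ for $x\in\mathbb{Z}^d$. For an $r$-dimensional lattice polytope $P$, $h^\varphi(P)(t)$ is defined by $\sum_{n\ge0}\varphi(nP)t^n=h^\varphi(P)(t)/(1-t)^{r+1}$. $\varphi$ is combinatorially positive if $G$ is a partially ordered abelian group and all coefficients of $h^\varphi(P)$ are $\ge0$ for all lattice polytopes $P$. *)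

(* Defs.v *)
From mathcomp Require Import all_boot all_order all_algebra.
From mathcomp Require Import boolp classical_sets reals.

Set Implicit Arguments.
Unset Strict Implicit.
Unset Printing Implicit Defensive.

Import Order.TTheory GRing.Theory Num.Theory.

Local Open Scope classical_set_scope.
Local Open Scope ring_scope.

Definition lattice_pt (R : realType) (d : nat) (x : 'rV[int]_d) : 'rV[R]_d :=
  map_mx intr x.

Definition convex_hull (R : realType) (d m : nat) (p : 'I_m -> 'rV[R]_d) :
    set 'rV[R]_d :=
  [set x | exists l : 'I_m -> R,
     [/\ forall i, 0 <= l i, \sum_i l i = 1 & x = \sum_i l i *: p i]].

(* [m = 0] gives the empty polytope. *)
Definition lattice_polytope (R : realType) (d : nat) (P : set 'rV[R]_d) : Prop :=
  exists (m : nat) (p : 'I_m -> 'rV[int]_d),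
    P = convex_hull (fun i => lattice_pt R (p i)).

Definition translate (R : realType) (d : nat) (x : 'rV[R]_d)
    (P : set 'rV[R]_d) : set 'rV[R]_d :=
  [set y + x | y in P].

Definition dilate (R : realType) (d n : nat) (P : set 'rV[R]_d) :
    set 'rV[R]_d :=
  [set n%:R *: y | y in P].

Definition affinely_independent (R : realType) (d r : nat)
    (p : 'I_r.+1 -> 'rV[R]_d) : bool :=
  free [seq p (lift ord0 i) - p ord0 | i : 'I_r].

(* The largest r such that P contains r + 1 affinely independent points, i.e.
   the dimension of the affine hull of P. The value on the empty set is 0
   instead of -1; this does not matter below, since [hcoef phi set0 k] is 0
   for every k as soon as [phi set0 = 0]. *)
Definition polytope_dim (R : realType) (d : nat) (P : set 'rV[R]_d) : nat :=
  \max_(r < d.+1 | `[< exists p : 'I_r.+1 -> 'rV[R]_d,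
                         (forall i, P (p i)) /\ affinely_independent p >]) r.

(* A valuation on lattice polytopes is a function on all subsets of R^d whose
   values outside lattice polytopes are irrelevant. *)
Definition Zd_valuation (R : realType) (d : nat) (G : zmodType)
    (phi : set 'rV[R]_d -> G) : Prop :=
  [/\ phi set0 = 0,
      forall P Q : set 'rV[R]_d,
        lattice_polytope P -> lattice_polytope Q ->
        lattice_polytope (P `|` Q) -> lattice_polytope (P `&` Q) ->
        phi (P `|` Q) = phi P + phi Q - phi (P `&` Q)
    & forall (P : set 'rV[R]_d) (x : 'rV[int]_d),
        lattice_polytope P -> phi (translate (lattice_pt R x) P) = phi P].

(* The coefficient of t^k in (1 - t)^(r+1) * \sum_n phi(nP) t^n, r = dim P. *)
Definition hcoef (R : realType) (d : nat) (G : zmodType)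
    (phi : set 'rV[R]_d -> G) (P : set 'rV[R]_d) (k : nat) : G :=
  \sum_(j < k.+1)
    phi (dilate (k - j)%N P)
      *~ ((1 - 'X : {poly int}) ^+ (polytope_dim P).+1)`_j.

(* [porderZmodType] does not relate the order to the addition. *)
Definition order_compatible (G : porderZmodType) : Prop :=
  forall x y z : G, x <= y -> z + x <= z + y.

Definition combinatorially_positive (R : realType) (d : nat)
    (G : porderZmodType) (phi : set 'rV[R]_d -> G) : Prop :=
  order_compatible G /\
  forall P : set 'rV[R]_d, lattice_polytope P ->
    forall k : nat, 0 <= hcoef phi P k.

Definition zonotope (R : realType) (d n : nat) (v : 'I_n -> 'rV[R]_d) :
    set 'rV[R]_d :=
  [set x | exists l : 'I_n -> R,
     (forall i, 0 <= l i <= 1) /\ x = \sum_i l i *: v i].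

Definition spanning (R : realType) (d n : nat) (v : 'I_n -> 'rV[R]_d) : Prop :=
  <<[seq v i | i : 'I_n]>>%VS = fullv.

Definition lin_indep (R : realType) (d n : nat) (v : 'I_n -> 'rV[R]_d)
    (I : {set 'I_n}) : bool :=
  free [seq v i | i in I].

Definition coloop_free (R : realType) (d n : nat) (v : 'I_n -> 'rV[R]_d) :
    Prop :=
  forall i : 'I_n,
    ~ (forall I : {set 'I_n}, maxset (lin_indep v) I -> i \in I).

(* The indices 0, d, 1, d-1, 2, ... in position j = 0, 1, 2, 3, 4, ...; the
   last one, in position d, is (d+1)./2. *)
Definition zigzag (d j : nat) : nat := if odd j then (d - j./2)%N else j./2.

Definition alternatingly_increasing (G : porderZmodType) (d : nat)
    (h : nat -> G) : Prop :=
  forall j : nat, (j < d)%N -> h (zigzag d j) <= h (zigzag d j.+1).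

(* Main.v *)
Require Import Defs.
From mathcomp Require Import all_boot all_order all_algebra.
From mathcomp Require Import boolp classical_sets reals.
(* [fintype] and [finset] again, so that [subsetP], [setIidPr] etc. refer to
   finite sets rather than to [classical_sets]. *)
From mathcomp Require Import fintype finset zify ring lra.

(* For a set I of generators let c_I be the value of phi on the half-open
   parallelepiped spanned by I (an alternating sum of phi over the closed
   zonotopes of the subsets of I), so that phi(kZ) is the sum of c_I k^|I|.
   The terms with I dependent vanish, and c_I is the sum over K \subset I of
   b_K, where b_K is the value on the open parallelepiped spanned by K; b_K is
   the top h-coefficient of the closed one, hence b_K >= 0. So the h-vector of Z
   is a combination, with coefficients b_K for K independent, of the h-vectors of
   f_K(x), the sum of x^|I| over the independent I containing K.

   To see c_I = 0 for dependent I, no extension of phi to half-open polytopes is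
   needed: if B \subset A and every point of A can be moved into B in direction
   x, then A + [0,x] is the union of A and B + [0,x], which intersect in B. Hence
   phi(A + [0,x]) - phi(A) only depends on the projection of A along x, and one
   removes the elements of I one by one.

   Since f_K = x^|K| f_{M/K}, where M/K is again coloop free, it remains to treat
   x^a f_M for a coloop-free matroid M. With S a series class of size s + 1 and
   q_s = (1+x)^{s+1} - x^{s+1}, one has f_M = q_s f_{M \ S} + x^{s+1} f_{M/S},
   and both minors are coloop free. Thus x^a f_M lies in the cone generated by
   the products x^{a+p} (1+x)^p q_s. The h-vector of q_s is Eulerian, so
   palindromic and unimodal; multiplication by x(1+x) preserves this, and
   multiplication by x preserves the alternatingly increasing vectors. *)

Set Implicit Arguments.
Unset Strict Implicit.
Unset Printing Implicit Defensive.

Import Order.TTheory GRing.Theory Num.Theory.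

Local Open Scope ring_scope.

(** * h-vectors *)

(* The coefficient of t^k in (1 - t)^(r+1) * \sum_n p(n) t^n. *)
Definition hvec (r : nat) (p : {poly int}) (k : nat) : int :=
  \sum_(j < k.+1) p.[(k - j)%N%:Z] * ((1 - 'X : {poly int}) ^+ r.+1)`_j.

(** Only the first k + 1 values matter for a coefficient of t^k, so a truncated series suffices;
    being a polynomial, it comes with derivatives and ring identities. *)
Definition trunc_gf (N : nat) (p : {poly int}) : {poly int} :=
  \poly_(i < N) p.[i%:Z].

Lemma hvecE (N r : nat) (p : {poly int}) (k : nat) :
  (k < N)%N -> hvec r p k = (trunc_gf N p * (1 - 'X) ^+ r.+1)`_k.
Proof.
move=> kN; rewrite coefMr; apply: eq_bigr => j _.
by rewrite coef_poly (leq_ltn_trans _ kN) // leq_subr.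
Qed.

Definition shift (h : nat -> int) (k : nat) : int := if k is k'.+1 then h k' else 0.

Lemma coefXM_shift (p : {poly int}) k : ('X * p)`_k = shift (fun i => p`_i) k.
Proof. by rewrite coefXM; case: k. Qed.

Lemma hvecD r p q k : hvec r (p + q) k = hvec r p k + hvec r q k.
Proof.
by rewrite -big_split; apply: eq_bigr => j _; rewrite hornerD mulrDl.
Qed.

Lemma hvec0 r k : hvec r 0 k = 0.
Proof. by apply: big1 => j _; rewrite horner0 mul0r. Qed.

Lemma hvecN r p k : hvec r (- p) k = - hvec r p k.
Proof. by apply/eqP; rewrite -addr_eq0 -hvecD addNr hvec0. Qed.

Lemma hvecS r p k : hvec r.+1 p k = hvec r p k - shift (hvec r p) k.
Proof.
rewrite !(@hvecE k.+1) // exprS mulrCA mulrBl mul1r coefB coefXM.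
by case: k => //= k; rewrite (@hvecE k.+2).
Qed.

(** Replacing p(n) by n p(n) applies t d/dt to the generating series. On H / (1 - t)^(r+1) this
    yields the numerator t (1 - t) H' + (r+1) t H over (1 - t)^(r+2). *)
Lemma hvecX r p k :
  hvec r.+1 ('X * p) k =
  k%:Z * hvec r p k + (r.+2%:Z - k%:Z) * shift (hvec r p) k.
Proof.
pose u := trunc_gf k.+1 p.
have uX : trunc_gf k.+1 ('X * p) = 'X * u^`().
  apply/polyP => i; rewrite coef_poly coefXM_shift.
  case: i => [|i] /=; first by rewrite hornerM hornerX mul0r.
  rewrite coef_deriv coef_poly; case: ifP => _; last by rewrite mul0rn.
  by rewrite hornerM hornerX -mulr_natl natz.
pose H := u * (1 - 'X) ^+ r.+1.
have dH : trunc_gf k.+1 ('X * p) * (1 - 'X) ^+ r.+2 =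
          'X * H^`() - 'X * ('X * H^`()) + 'X * H *+ r.+1.
  rewrite uX /H derivM deriv_exp derivB derivC derivX /=.
  rewrite sub0r -mulr_natr -[_ *+ r.+1]mulr_natr !exprS.
  by ring.
rewrite (@hvecE k.+1) // dH !coefD coefN coefMn !coefXM !coef_deriv.
case: k @u @H uX dH => [|k] u H uX dH /=.
  by rewrite mul0r mulr0 mul0rn subr0 !addr0.
rewrite !(@hvecE k.+2) // -/u -/H.
clear dH uX; clearbody H; clear u; case: k H => [|k] H /=.
  move: (H`_1) (H`_0) => a b.
  rewrite mulr1n -mulr_natr natz (intS r.+1) (intS r); ring.
move: (H`_k.+2) (H`_k.+1) => a b.
rewrite -[b *+ k.+1]mulr_natr -[b *+ r.+1]mulr_natr -[a *+ _]mulr_natr !natz.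
rewrite (intS r.+1) (intS r) (intS k.+1) (intS k); ring.
Qed.

Lemma hvecX1 r p k :
  hvec r.+1 ((1 + 'X) * p) k =
  k.+1%:Z * hvec r p k + (r.+1%:Z - k%:Z) * shift (hvec r p) k.
Proof. by rewrite mulrDl mul1r hvecD hvecS hvecX; lia. Qed.

(** The sign (-1)^(r-i) is the one occurring in a Möbius sum over subsets; this identifies the top
    h-coefficient of a parallelepiped with such a sum in [mobius_half_open_value_ge0]. *)
Lemma hvec_Xn_top r i : (i <= r)%N -> hvec r 'X^i r = (-1) ^+ (r - i) /\
  forall k, (r < k)%N -> hvec r 'X^i k = 0.
Proof.
elim: r i => [|r IHr] i.
  rewrite leqn0 => /eqP ->; rewrite expr0; split.
    by rewrite /hvec big_ord1 hornerC mul1r expr1 coefB coef1 coefX.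
  move=> k k_gt0; rewrite (@hvecE k.+1) // expr1 mulrBr mulr1 coefB coefMX.
  rewrite !coef_poly ltnSn; case: k k_gt0 => // k _ /=.
  by rewrite (leqW _) // !hornerC subrr.
rewrite leq_eqVlt => /orP[/eqP ->|].
  rewrite exprS subnn expr0; have [h1 h0] := IHr _ (leqnn r).
  split; first by rewrite hvecX h0 // mulr0 add0r /= h1 subnn expr0; lia.
  by case=> // k rk; rewrite hvecX /= !h0 ?mulr0 ?addr0 //; lia.
rewrite ltnS => ir; have [h1 h0] := IHr _ ir; split.
  by rewrite hvecS /= h0 // h1 sub0r subSn // exprS mulN1r.
by case=> // k rk; rewrite hvecS /= !h0 ?subr0 //; lia.
Qed.

(** The independence polynomial of a circuit with s + 1 elements: all proper subsets are
    independent. *)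
Definition qpoly (s : nat) : {poly int} := (1 + 'X) ^+ s.+1 - 'X ^+ s.+1.

Lemma qpolyM s t :
  qpoly s.+1 * qpoly t.+1 = 'X * ((1 + 'X) * (qpoly s * qpoly t)) + qpoly (s + t).+2.
Proof.
rewrite /qpoly !exprS exprD [in X in _ = _ + X]exprD; ring.
Qed.

Lemma qpoly0 : qpoly 0 = 1.
Proof. by rewrite /qpoly !expr1 addrK. Qed.

(** * Palindromic unimodal and alternatingly increasing integer vectors *)

Definition palindromic_unimodal (d : nat) (h : nat -> int) : Prop :=
  [/\ 0 <= h 0%N, forall k, (d < k)%N -> h k = 0,
      forall k, (k <= d)%N -> h (d - k)%N = h k
    & forall k, (k.*2 < d)%N -> h k <= h k.+1].

(** The last two clauses are the steps of the zigzag from even and from odd positions. Nonnegativity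
    and vanishing beyond [d] are carried along because the recursions reach past both ends. *)
Definition zigzag_increasing (d : nat) (h : nat -> int) : Prop :=
  [/\ 0 <= h 0%N, forall k, (d < k)%N -> h k = 0,
      forall k, (k.*2 < d)%N -> h k <= h (d - k)%N
    & forall k, (k.*2.+1 < d)%N -> h (d - k)%N <= h k.+1].

Lemma palindromic_unimodal_zigzag d h : palindromic_unimodal d h -> zigzag_increasing d h.
Proof.
case=> h0 hd hs hu; split=> // k kd; first by rewrite hs //; lia.
by rewrite hs; [apply: hu|]; lia.
Qed.

Lemma palindromic_unimodalD d h h' : palindromic_unimodal d h -> palindromic_unimodal d h' -> palindromic_unimodal d (fun k => h k + h' k).
Proof.
move=> [h0 hd hs hu] [h0' hd' hs' hu']; split=> [|k kd|k kd|k kd].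
- exact: addr_ge0.
- by rewrite hd // hd'.
- by rewrite hs // hs'.
- by rewrite lerD // (hu, hu').
Qed.

Lemma zigzag_increasingD d h h' : zigzag_increasing d h -> zigzag_increasing d h' -> zigzag_increasing d (fun k => h k + h' k).
Proof.
move=> [h0 hd hs hu] [h0' hd' hs' hu']; split=> [|k kd|k kd|k kd].
- exact: addr_ge0.
- by rewrite hd // hd'.
- by rewrite lerD // (hs, hs').
- by rewrite lerD // (hu, hu').
Qed.

(* The recursion is that of the Eulerian numbers A(d+1, k). *)
Lemma palindromic_unimodal_eulerian d h h' : palindromic_unimodal d h ->
  (forall k, h' k = k.+1%:Z * h k + (d.+2%:Z - k%:Z) * shift h k) ->
  palindromic_unimodal d.+1 h'.
Proof.
move=> [h0 hd hs hu] E.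
have sym k : (k <= d.+1)%N -> h' (d.+1 - k)%N = h' k.
  move=> kd; rewrite !E; case: k kd => [|k] kd.
    by rewrite subn0 /= hd // -(hs 0%N) // subn0; lia.
  rewrite subSS /= hs //; move: kd; rewrite ltnS leq_eqVlt => /orP[/eqP ->|kd].
    by rewrite subnn /= (hd d.+1) //; lia.
  have -> : (d - k)%N = (d - k.+1).+1 by lia.
  rewrite /= hs //; set m := (d - k.+1)%N.
  have -> : d = (m + k.+1)%N by lia.
  lia.
split=> [|k kd|//|k kd].
- by rewrite E /=; lia.
- rewrite E hd ?mulr0 ?add0r; last lia.
  by case: k kd => // k kd /=; rewrite hd ?mulr0.
(* If 2k = d, then k and k + 1 are mirror images for length d + 1, so the two entries are equal. *)
case: (ltngtP k.*2 d) => kd'; try lia; last first.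
  by rewrite -(sym k); [have -> : (d.+1 - k)%N = k.+1 by lia|lia].
have h1 := hu _ kd'.
have h2 : shift h k <= h k.
  by case: k {h1} kd kd' => [|k] kd kd' //=; apply: hu; lia.
rewrite -subr_ge0 !E /=.
have -> : k.+2%:Z * h k.+1 + (d.+2%:Z - k.+1%:Z) * h k -
  (k.+1%:Z * h k + (d.+2%:Z - k%:Z) * shift h k) =
  k.+2%:Z * (h k.+1 - h k) + (d.+2%:Z - k%:Z) * (h k - shift h k).
  rewrite (intS d.+1) (intS d) (intS k.+1) (intS k); ring.
by rewrite addr_ge0 // mulr_ge0 // ?subr_ge0 //; lia.
Qed.

(** In either comparison both sides carry total weight d + 2 on entries of [h], and the weight on
    the right sits on entries that are at least as large in the zigzag order. The entries at the
    ends, where [shift] vanishes, are treated apart. *)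
Lemma zigzag_increasing_mulX d h h' : zigzag_increasing d h ->
  (forall k, h' k = k%:Z * h k + (d.+2%:Z - k%:Z) * shift h k) ->
  zigzag_increasing d.+1 h'.
Proof.
move=> [h0 hd hs hu] E; split=> [|k kd|k kd|k kd].
- by rewrite E /=; lia.
- rewrite E hd ?mulr0 ?add0r; last lia.
  by case: k kd => // k kd /=; rewrite hd ?mulr0.
- have h1 : h k <= h (d - k)%N.
    case: (ltngtP k.*2 d) => kd'; [exact: hs|lia|].
    by have -> : (d - k)%N = k by lia.
  rewrite !E; case: k kd h1 => [|k] kd.
    by rewrite !subn0 (hd d.+1) //=; lia.
  have : h k <= h (d - k)%N by apply: hs; lia.
  have : h (d - k)%N <= h k.+1 by apply: hu; lia.
  rewrite subSS; have -> : (d - k)%N = (d - k.+1).+1 by lia.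
  set m := (d - k.+1)%N; have -> : d = (m + k.+1)%N by lia.
  rewrite /=; move: (h k) (h k.+1) (h m) (h m.+1) => a b c e; nia.
- rewrite !E.
  have h1 : h (d - k)%N <= h k.+1.
    case: (ltngtP k.*2.+1 d) => kd'; [exact: hu|lia|].
    by have -> : (d - k)%N = k.+1 by lia.
  case: k kd h1 => [|k] kd.
    by rewrite !subn0 (hd d.+1) //=; lia.
  have : h (d - k)%N <= h k.+1 by apply: hu; lia.
  rewrite subSS; have -> : (d - k)%N = (d - k.+1).+1 by lia.
  set m := (d - k.+1)%N; have -> : d = (m + k.+1)%N by lia.
  rewrite /=; move: (h k.+1) (h k.+2) (h m) (h m.+1) => a b c e; nia.
Qed.

Lemma palindromic_unimodal_shift d h i j : palindromic_unimodal d h -> (i + j = d.+2)%N ->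
  shift (shift h) j = h i /\ shift h i = shift h j.
Proof.
move=> [_ hd hs _] ij; split.
  case: j ij => [|[|j]] ij /=; try by rewrite hd //; lia.
  by rewrite -(hs j); [congr h|]; lia.
case: i j ij => [|i] [|j] ij //=; try by rewrite hd //; lia.
by rewrite -(hs j); [congr h|]; lia.
Qed.

(** Here [g] is the h-vector after multiplication by x and [f] the one after a further
    multiplication by 1 + x. The first step alone breaks the symmetry, hence the direct three-term
    formula [E] for the composite. *)
Lemma palindromic_unimodal_mulXX1 d h g f : palindromic_unimodal d h ->
  (forall k, g k = k%:Z * h k + (d.+2%:Z - k%:Z) * shift h k) ->
  (forall k, f k = k.+1%:Z * g k + (d.+2%:Z - k%:Z) * shift g k) ->
  palindromic_unimodal d.+2 f.
Proof.
move=> symh0 Eg Ef; have [h0 hd hs hu] := symh0.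
have E k : f k = k%:Z * k.+1%:Z * h k +
    2 * k%:Z * (d.+2%:Z - k%:Z) * shift h k +
    (d.+2%:Z - k%:Z) * (d.+3%:Z - k%:Z) * shift (shift h) k.
  rewrite Ef Eg; case: k => [|k] /=; first by ring.
  by rewrite Eg (intS d.+2) (intS k.+1) (intS k); ring.
(* The reflection k -> d + 2 - k exchanges the outer terms of [E] and fixes the middle one. *)
have sym k : (k <= d.+2)%N -> f (d.+2 - k)%N = f k.
  move=> kd; set j := (d.+2 - k)%N; have kj : (k + j = d.+2)%N by rewrite /j; lia.
  have [e1 e2] := palindromic_unimodal_shift symh0 kj.
  have [e3 _] : shift (shift h) k = h j /\ shift h j = shift h k.
    by apply: palindromic_unimodal_shift symh0 _; lia.
  rewrite !E e1 e2 e3 (intS d.+2) -kj.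
  move: (h k) (h j) (shift h j) => a b c; rewrite PoszD (intS k) (intS j); ring.
have h1 k : (k.*2 <= d.+1)%N -> shift h k <= h k.
  case: k => [|k] kd //=.
  case: (ltngtP k.*2.+1 d) => kd'; [apply: hu|lia|apply: hu]; lia.
have h2 k : (k.*2 <= d.+3)%N -> shift (shift h) k <= shift h k.
  by case: k => [|k] kd //=; apply: h1; lia.
split=> [|k kd|//|k kd].
- by rewrite E; cbn [shift]; lia.
- rewrite E hd ?mulr0 ?add0r; last lia.
  case: k kd => [//|[//|k]] kd; cbn [shift]; rewrite (hd k.+1) ?mulr0 ?add0r; last lia.
  have [->|dk] := eqVneq k d.+1; first by rewrite subrr mulr0 mul0r.
  by rewrite hd ?mulr0 //; lia.
case: (ltngtP k.*2.+1 d.+2) => kd'; try lia; last first.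
  by rewrite -(sym k); [have -> : (d.+2 - k)%N = k.+1 by lia|lia].
have {h1 h2} [h1 h2] : shift h k <= h k /\ shift (shift h) k <= shift h k.
  by split; [apply: h1|apply: h2]; lia.
rewrite -subr_ge0 !E.
set m := (d.+2 - k)%N; have dE : d.+2%:Z - k%:Z = m%:Z by rewrite /m; lia.
have -> : d.+3%:Z - k%:Z = m%:Z + 1 by lia.
have -> : d.+2%:Z - k.+1%:Z = m%:Z - 1 by lia.
have -> : d.+3%:Z - k.+1%:Z = m%:Z by lia.
rewrite dE (intS k.+1) (intS k) [shift h k.+1]/= [shift (shift h) k.+1]/=.
case: (ltngtP k.*2 d) => kd2.
- have := hu _ kd2; move: (h k) (h k.+1) (shift h k) (shift (shift h) k) h1 h2.
  move=> b a c e h1 h2 h3.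
  rewrite (_ : _ - _ = (k%:Z + 1) * (k%:Z + 2) * (a - b) +
     2 * m%:Z * (k%:Z + 1) * (b - c) + m%:Z * (m%:Z + 1) * (c - e)); last by ring.
  by rewrite !addr_ge0 // mulr_ge0 // ?subr_ge0 //; lia.
- lia.
(* In the middle, 2k = d, the increment from h(k) to h(k+1) can be negative. By symmetry it is the
   opposite of the preceding increment, and since m = k + 2 half of the second term absorbs it. *)
- have -> : h k.+1 = shift h k.
    case: k kd2 {sym kd kd' h1 h2 m dE} => [|k] kd2 /=; first by rewrite hd //; lia.
    by rewrite -(hs k); [congr h|]; lia.
  have -> : m%:Z = k%:Z + 2 by lia.
  move: (h k) (shift h k) (shift (shift h) k) h1 h2 => b c e h1 h2.
  rewrite (_ : _ - _ = (k%:Z + 1) * (k%:Z + 2) * (b - c) +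
     (k%:Z + 2) * (k%:Z + 3) * (c - e)); last by ring.
  by rewrite !addr_ge0 // mulr_ge0 // ?subr_ge0 //; lia.
Qed.

Lemma eq_symh d h h' : h =1 h' -> palindromic_unimodal d h -> palindromic_unimodal d h'.
Proof.
move=> e [h0 hd hs hu]; split=> [|k kd|k kd|k kd]; rewrite -!e //.
- exact: hd.
- exact: hs.
- exact: hu.
Qed.

Lemma eq_alth d h h' : h =1 h' -> zigzag_increasing d h -> zigzag_increasing d h'.
Proof.
move=> e [h0 hd hs hu]; split=> [|k kd|k kd|k kd]; rewrite -!e //.
- exact: hd.
- exact: hs.
- exact: hu.
Qed.

(** Since n^(s+1) vanishes at n = 0, its generating series is t times that of (n+1)^(s+1). *)
Lemma hvec_XnX1n s k : hvec s.+1 ('X ^+ s.+1) k = shift (hvec s.+1 ((1 + 'X) ^+ s.+1)) k.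
Proof.
elim: s k => [|s IHs] k.
  rewrite !expr1 -[in LHS](mulr1 'X) -[in RHS](mulr1 (1 + 'X)) hvecX.
  have c1 j : hvec 0 1 j = (j == 0%N)%:R.
    rewrite (@hvecE j.+1) // expr1 mulrBr mulr1 coefB coefMX !coef_poly.
    by case: j => [|j]; rewrite !hornerC ltnSn ?subr0 //= (leqW _) // subrr.
  case: k => [|k] /=; first by rewrite c1; lia.
  by rewrite hvecX1 !c1; case: k => [|[|k]] //=; rewrite ?c1 ?mulr0 //; lia.
rewrite exprS hvecX IHs; case: k => [|k] /=; first by rewrite mul0r mulr0.
rewrite IHs [in RHS]exprS hvecX1; case: k => [|k] /=; first by ring.
rewrite (intS s.+2) (intS k.+1); ring.
Qed.

(** In dimension s + 1 the h-vector of q_s is h - th, with h that of (1+x)^(s+1); dropping one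
    factor 1 - t leaves h, the Eulerian vector. *)
Lemma hvec_qpoly s k : hvec s (qpoly s) k = hvec s.+1 ((1 + 'X) ^+ s.+1) k.
Proof.
have E j : hvec s (qpoly s) j - shift (hvec s (qpoly s)) j =
  hvec s.+1 ((1 + 'X) ^+ s.+1) j - shift (hvec s.+1 ((1 + 'X) ^+ s.+1)) j.
  by rewrite -hvecS /qpoly hvecD hvecN hvec_XnX1n.
elim: k => [|k IHk]; first by have := E 0%N; rewrite /= !subr0.
by have := E k.+1; rewrite /= IHk => /addIr.
Qed.

Lemma palindromic_unimodal_qpoly s : palindromic_unimodal s (hvec s (qpoly s)).
Proof.
apply: (eq_symh (fun k => esym (hvec_qpoly s k))).
elim: s => [|s IHs].
  have E k : hvec 1 ((1 + 'X) ^+ 1) k = (k == 0%N)%:R.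
    rewrite -hvec_qpoly qpoly0.
    rewrite (@hvecE k.+1) // expr1 mulrBr mulr1 coefB coefMX !coef_poly.
    by case: k => [|k]; rewrite !hornerC ltnSn ?subr0 //= (leqW _) // subrr.
  by split=> [|[]//|[]//|//]; rewrite !E.
apply: palindromic_unimodal_eulerian IHs _ => k; rewrite exprS hvecX1; congr (_ + _).
Qed.

(** The index is the dimension in which the h-vector is taken, so only polynomials of equal index
    are added, and each factor x or 1 + x raises it by one. *)
Inductive sym_cone : nat -> {poly int} -> Prop :=
| sym_cone0 d : sym_cone d 0
| sym_coneD d p q : sym_cone d p -> sym_cone d q -> sym_cone d (p + q)
| sym_coneq s : sym_cone s (qpoly s)
| sym_coneX d p : sym_cone d p -> sym_cone d.+2 ('X * ((1 + 'X) * p)).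

Inductive alt_cone : nat -> {poly int} -> Prop :=
| alt_cone_sym d p : sym_cone d p -> alt_cone d p
| alt_coneD d p q : alt_cone d p -> alt_cone d q -> alt_cone d (p + q)
| alt_coneX d p : alt_cone d p -> alt_cone d.+1 ('X * p).

Lemma sym_cone_hvec d p : sym_cone d p -> palindromic_unimodal d (hvec d p).
Proof.
elim=> {d p} [d|d p q _ IHp _ IHq|s|d p _ IHp].
- by split=> *; rewrite !hvec0.
- exact: eq_symh (fun k => esym (hvecD d p q k)) (palindromic_unimodalD IHp IHq).
- exact: palindromic_unimodal_qpoly.
- rewrite mulrCA; apply: (palindromic_unimodal_mulXX1 IHp) => k; first exact: hvecX.
  by rewrite hvecX1.
Qed.

Lemma alt_cone_hvec d p : alt_cone d p -> zigzag_increasing d (hvec d p).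
Proof.
elim=> {d p} [d p /sym_cone_hvec/palindromic_unimodal_zigzag//|d p q _ IHp _ IHq|d p _ IHp].
- exact: eq_alth (fun k => esym (hvecD d p q k)) (zigzag_increasingD IHp IHq).
- by apply: (zigzag_increasing_mulX IHp) => k; rewrite hvecX.
Qed.

(** By [qpolyM] a product of two q's is x(1+x) times a smaller such product plus a single q; the
    recursion ends at q_0 = 1. *)
Lemma sym_cone_qpolyM s t : sym_cone (s + t) (qpoly s * qpoly t).
Proof.
elim: s t => [|s IHs] t; first by rewrite qpoly0 mul1r; apply: sym_coneq.
case: t => [|t]; first by rewrite qpoly0 mulr1 addn0; apply: sym_coneq.
rewrite qpolyM addSn addnS; apply: sym_coneD; last exact: sym_coneq.
exact/sym_coneX/IHs.
Qed.

Lemma sym_coneM d p t : sym_cone d p -> sym_cone (d + t) (p * qpoly t).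
Proof.
elim=> {d p} [d|d p q _ IHp _ IHq|s|d p _ IHp].
- by rewrite mul0r; apply: sym_cone0.
- by rewrite mulrDl; apply: sym_coneD.
- exact: sym_cone_qpolyM.
- by rewrite -!mulrA !addSn; apply: sym_coneX.
Qed.

Lemma alt_coneM d p t : alt_cone d p -> alt_cone (d + t) (p * qpoly t).
Proof.
elim=> {d p} [d p hp|d p q _ IHp _ IHq|d p _ IHp].
- exact/alt_cone_sym/sym_coneM.
- by rewrite mulrDl; apply: alt_coneD.
- by rewrite -mulrA addSn; apply: alt_coneX.
Qed.

Lemma alt_coneXn n d p : alt_cone d p -> alt_cone (n + d) ('X^n * p).
Proof.
move=> hp; elim: n => [|n IHn]; first by rewrite expr0 mul1r.
by rewrite exprS -mulrA addSn; apply: alt_coneX.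
Qed.

Lemma alt_cone1 : alt_cone 0 1.
Proof. by rewrite -qpoly0; apply/alt_cone_sym/sym_coneq. Qed.

(** * Coloop-free matroids *)

Lemma big_subset_setD1 (V : nmodType) (T : finType) (I : {set T}) (x : T)
    (g : {set T} -> V) : x \in I ->
  \sum_(L : {set T} | L \subset I) g L =
  \sum_(L : {set T} | L \subset I :\ x) (g L + g (x |: L)).
Proof.
move=> xI; rewrite big_split /= (bigID (fun L : {set T} => x \notin L)) /=.
congr (_ + _).
  by apply: eq_bigl => L; rewrite subsetD1.
rewrite (reindex_onto (fun L => x |: L) (fun L => L :\ x)) /=; last first.
  by move=> L /andP[_ /negPn xL]; rewrite setD1K.
apply: eq_bigl => L; rewrite setU11 andbT subUset sub1set xI /= subsetD1.
case: (boolP (L \subset I)) => //= _.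
by case: (boolP (x \in L)) => xL; [apply/eqP => e; move: xL; rewrite -e !inE eqxx|
  rewrite setU1K ?eqxx].
Qed.

Lemma big_subset_Xn (T : finType) (S : {set T}) :
  \sum_(A : {set T} | A \subset S) 'X^#|A| = (1 + 'X) ^+ #|S| :> {poly int}.
Proof.
have [n] := ubnP #|S|; elim: n S => // n IHn S Sn.
have [->|[x xS]] := set_0Vmem S.
  rewrite cards0 expr0 (eq_bigl (pred1 set0)); last by move=> A; rewrite subset0.
  by rewrite big_pred1_eq cards0 expr0.
have cS : #|S| = #|S :\ x|.+1 by rewrite (cardsD1 x) xS.
rewrite (big_subset_setD1 _ xS) cS exprS -IHn; last by rewrite -ltnS -cS.
rewrite big_distrr /=; apply: eq_bigr => A; rewrite subsetD1 => /andP[_ xA].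
by rewrite cardsU1 xA /= exprS mulrDl mul1r.
Qed.

(** Loops are allowed, so that minors can live on the same ground set. Coloop-freeness is
    [ind_avoid], which loops satisfy automatically. *)
Record coloop_free_matroid (T : finType) (ind : pred {set T}) (r : nat) : Prop :=
  ColoopFreeMatroid {
    indS : forall A B : {set T}, A \subset B -> ind B -> ind A;
    ind_augment : forall A B : {set T}, ind A -> ind B -> (#|A| < #|B|)%N ->
      exists x, [/\ x \in B, x \notin A & ind (x |: A)];
    ind_leq_rank : forall A : {set T}, ind A -> (#|A| <= r)%N;
    ind_basis : exists2 B : {set T}, ind B & #|B| = r;
    ind_avoid : forall x : T, exists B : {set T}, [/\ ind B, #|B| = r & x \notin B] }.

(* The ground set is not changed by minors: the elements of [S] become loops. *)
Definition contraction (T : finType) (ind : pred {set T}) (S : {set T}) : pred {set T} :=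
  fun J => [disjoint J & S] && ind (J :|: S).

Definition deletion (T : finType) (ind : pred {set T}) (S : {set T}) : pred {set T} :=
  fun J => [disjoint J & S] && ind J.

Definition indep_poly (T : finType) (ind : pred {set T}) : {poly int} :=
  \sum_(I : {set T} | ind I) 'X^#|I|.

Section Matroid.
Variables (T : finType) (ind : pred {set T}) (r : nat).
Hypothesis M : coloop_free_matroid ind r.

Lemma ind_extend (A B : {set T}) : ind A -> ind B -> (#|A| <= #|B|)%N ->
  exists C : {set T}, [/\ ind C, #|C| = #|B|, A \subset C & C \subset A :|: B].
Proof.
have [n] := ubnP (#|B| - #|A|)%N; elim: n A => // n IHn A An iA iB.
rewrite leq_eqVlt => /orP[/eqP e|AB].
  by exists A; split=> //; apply: subsetUl.
have [x [xB xA ixA]] := ind_augment M iA iB AB.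
have cx : #|x |: A| = #|A|.+1 by rewrite cardsU1 xA.
have [||C [iC cC AC CB]] := IHn (x |: A) _ ixA iB; rewrite ?cx //; first lia.
exists C; split=> //; first exact: subset_trans (subsetUr _ _) AC.
apply: subset_trans CB _; rewrite !subUset sub1set !inE xB orbT subsetUl.
exact: subsetUr.
Qed.

Lemma ind_extend_basis (A : {set T}) : ind A ->
  exists C : {set T}, [/\ ind C, #|C| = r & A \subset C].
Proof.
move=> iA; have [B iB cB] := ind_basis M.
have [|C [iC cC AC _]] := ind_extend iA iB; last by exists C; rewrite cC.
by rewrite cB (ind_leq_rank M).
Qed.

Lemma ind_extend_avoid (A : {set T}) x : ind A -> x \notin A ->
  exists C : {set T}, [/\ ind C, #|C| = r, A \subset C & x \notin C].
Proof.
move=> iA xA; have [B [iB cB xB]] := ind_avoid M x.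
have [|C [iC cC AC CB]] := ind_extend iA iB; first by rewrite cB (ind_leq_rank M).
exists C; rewrite cC; split=> //; apply: contra xA => /(subsetP CB).
by rewrite inE (negPf xB) orbF.
Qed.

(** Contraction creates no coloop: for x outside [S], [S] extends to a basis that misses x, using
    elements of a basis that misses x. *)
Lemma contraction_matroid (S : {set T}) : ind S ->
  coloop_free_matroid (contraction ind S) (r - #|S|).
Proof.
move=> iS.
have cU (J : {set T}) : [disjoint J & S] -> #|J :|: S| = (#|J| + #|S|)%N.
  by rewrite -leq_card_setU => /eqP.
have quot (C : {set T}) : ind C -> #|C| = r -> S \subset C ->
    contraction ind S (C :\: S) /\ #|C :\: S| = (r - #|S|)%N.
  move=> iC cC SC; split; last by rewrite cardsD (setIidPr SC) cC.
  rewrite /contraction disjoints_subset subsetDr /=.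
  by rewrite setUC -{1}(setIidPr SC) setID.
split.
- move=> A B AB /andP[dB iB]; rewrite /contraction (disjointWl AB dB) /=.
  by apply: (indS M _ iB); apply: setSU.
- move=> A B /andP[dA iA] /andP[dB iB] AB.
  have [|x []] := ind_augment M iA iB; first by rewrite !cU // ltn_add2r.
  rewrite !inE => /orP[xB|->]; last by rewrite orbT.
  rewrite negb_or => /andP[xA xS] ix; exists x; split=> //.
  rewrite /contraction -setUA ix andbT disjoints_subset subUset sub1set inE xS.
  by rewrite -disjoints_subset.
- by move=> A /andP[dA /(ind_leq_rank M)]; rewrite cU //; lia.
- have [C [iC cC SC]] := ind_extend_basis iS.
  by exists (C :\: S); case: (quot C).
- move=> x; have [xS|xS] := boolP (x \in S).
    have [C [iC cC SC]] := ind_extend_basis iS; have [? ?] := quot C iC cC SC.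
    by exists (C :\: S); rewrite !inE xS.
  have [C [iC cC SC xC]] := ind_extend_avoid iS xS; have [? ?] := quot C iC cC SC.
  by exists (C :\: S); rewrite !inE (negPf xC) andbF.
Qed.

(** Besides [e] these are the coloops of the deletion of [e]; they have to be deleted together with
    [e] to keep the matroid coloop free. *)
Definition series_class (e : T) : {set T} :=
  [set f | (f == e) ||
    [forall B : {set T}, [&& ind B, #|B| == r & e \notin B] ==> (f \in B)]].

Lemma series_classP e f : reflect
  (f = e \/ forall B : {set T}, ind B -> #|B| = r -> e \notin B -> f \in B)
  (f \in series_class e).
Proof.
rewrite inE; apply: (iffP orP) => -[/eqP|]; try by left.
- move=> /forallP H; right=> B iB cB eB.
  by apply: (implyP (H B)); rewrite iB cB eqxx eB.
- move=> H; right; apply/forallP => B; apply/implyP => /and3P[iB /eqP cB eB].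
  exact: H.
Qed.

(** For f = e this is the definition. Otherwise [e] lies in [B]; if g were missing too, exchanging
    [e] for some y of a basis avoiding [e] would give a basis without [e], hence with both f and g,
    so that f = y = g. *)
Lemma series_class_basis (e f : T) (B : {set T}) : f \in series_class e ->
  ind B -> #|B| = r -> f \notin B -> series_class e :\ f \subset B.
Proof.
move=> fS iB cB fB; apply/subsetP => g; rewrite in_setD1 => /andP[gf gS].
have [fE|fe] := eqVneq f e.
  case/series_classP: gS => [ge|]; first by rewrite ge fE eqxx in gf.
  by apply=> //; rewrite -fE.
case/series_classP: fS => [fE|fS]; first by rewrite fE eqxx in fe.
have eB : e \in B by apply: contraR fB; apply: fS.
case/series_classP: gS => [->//|gS].
apply/negPn/negP => gB.
have [B' [iB' cB' eB']] := ind_avoid M e.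
have cBe : #|B| = #|B :\ e|.+1 by rewrite (cardsD1 e) eB.
have [|y [yB' yB iy]] := ind_augment M (indS M (subD1set B e) iB) iB'.
  by rewrite cB' -cB cBe.
have ye : y != e by apply: contraNneq eB' => <-.
have cy : #|y |: (B :\ e)| = r by rewrite cardsU1 yB add1n -cBe.
have ey : e \notin y |: (B :\ e) by rewrite !inE eqxx orbF eq_sym.
have := fS _ iy cy ey; have := gS _ iy cy ey.
rewrite !inE (negPf gB) (negPf fB) !andbF !orbF => /eqP gy /eqP fy.
by rewrite gy fy eqxx in gf.
Qed.

(** The class behaves like a circuit relative to sets disjoint from it: a basis that contains [J]
    and misses [f] contains the rest of the class. *)
Lemma series_class_ind (e f : T) (J : {set T}) : f \in series_class e ->
  ind J -> [disjoint J & series_class e] -> ind (J :|: series_class e :\ f).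
Proof.
move=> fS iJ dJ.
have fJ : f \notin J by rewrite (disjointFl dJ).
have [C [iC cC JC fC]] := ind_extend_avoid iJ fJ.
apply: (indS M _ iC); rewrite subUset JC.
exact: series_class_basis fS iC cC fC.
Qed.

Lemma series_class_id e : e \in series_class e.
Proof. by rewrite inE eqxx. Qed.

(** A basis without [e] contains the s other elements of the class, so removing the class leaves r -
    s elements. An x outside the class is by definition missed by some basis without [e], whence no
    coloop arises. *)
Lemma deletion_matroid e s : #|series_class e| = s.+1 ->
  (s <= r)%N /\ coloop_free_matroid (deletion ind (series_class e)) (r - s).
Proof.
set S := series_class e => cS.
have cSe : #|S :\ e| = s by apply/eqP; rewrite -eqSS -cS (cardsD1 e S) series_class_id.
have quot (B : {set T}) : ind B -> #|B| = r -> e \notin B ->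
    [/\ (s <= r)%N, deletion ind S (B :\: S) & #|B :\: S| = (r - s)%N].
  move=> iB cB eB; have SB := series_class_basis (series_class_id e) iB cB eB.
  have sr : (s <= r)%N by rewrite -cB -cSe subset_leq_card.
  split=> //.
    by rewrite /deletion disjoints_subset subsetDr (indS M (subsetDl _ _) iB).
  have -> : B :\: S = B :\: (S :\ e).
    apply/setP => x; rewrite !in_setD in_set1.
    by case: eqP => [->|]; rewrite ?(negPf eB) ?andbF.
  by rewrite cardsD (setIidPr SB) cB cSe.
have [B [iB cB eB]] := ind_avoid M e.
have [sr dB cBS] := quot B iB cB eB.
split=> //; split.
- move=> A C AC /andP[dC iC].
  by rewrite /deletion (disjointWl AC dC) (indS M AC iC).
- move=> A C /andP[dA iA] /andP[dC iC] AC.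
  have [x [xC xA ix]] := ind_augment M iA iC AC; exists x; split=> //.
  rewrite /deletion ix andbT disjoints_subset subUset sub1set inE (disjointFr dC) //.
  by rewrite -disjoints_subset.
- move=> A /andP[dA iA].
  have := ind_leq_rank M (series_class_ind (series_class_id e) iA dA).
  rewrite cardsU (disjoint_setI0 _) ?cards0 ?cSe; first by lia.
  by apply: disjointWr dA; apply: subD1set.
- by exists (B :\: S).
- move=> x; have [xS|xS] := boolP (x \in S).
    by exists (B :\: S); rewrite in_setD xS.
  have := xS; rewrite inE negb_or => /andP[_].
  case/forallPn => C; rewrite negb_imply => /andP[/and3P[iC /eqP cC eC] xC].
  have [_ dC cCS] := quot C iC cC eC.
  by exists (C :\: S); rewrite in_setD (negPf xC) andbF.
Qed.

End Matroid.

(** * Independence polynomials of minors *)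

Lemma indep_poly_above (T : finType) (ind : pred {set T}) (K : {set T}) :
  \sum_(I : {set T} | ind I && (K \subset I)) 'X^#|I| =
  'X^#|K| * indep_poly (contraction ind K).
Proof.
rewrite /indep_poly big_distrr /=.
rewrite (reindex_onto (fun J => J :|: K) (fun I => I :\: K)) /=; last first.
  by move=> I /andP[_ KI]; rewrite setUC -{1}(setIidPr KI) setID.
apply: eq_big => J.
  rewrite subsetUr andbT /contraction andbC; congr (_ && _).
  rewrite setDUl setDv setU0 disjoints_subset.
  by apply/eqP/idP => [<-|dJ]; [apply: subsetDr|rewrite setDE (setIidPl dJ)].
move=> /andP[_ /eqP <-]; rewrite setDUl setDv setU0 -exprD; congr 'X^_.
by apply/eqP; rewrite addnC (leq_card_setU _ _).2 disjoints_subset subsetDr.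
Qed.

(** The independent sets containing [S] come from the contraction. Any other one is a union of an
    independent [J] off [S] and a proper subset of [S], and the two can be chosen freely. *)
Lemma indep_poly_series (T : finType) (ind : pred {set T}) (S : {set T}) (s : nat) :
  (forall A B : {set T}, A \subset B -> ind B -> ind A) -> #|S| = s.+1 ->
  (forall f (J : {set T}), f \in S -> ind J -> [disjoint J & S] -> ind (J :|: S :\ f)) ->
  indep_poly ind = indep_poly (deletion ind S) * qpoly s +
                   'X ^+ s.+1 * indep_poly (contraction ind S).
Proof.
move=> her cS serS; rewrite -cS -indep_poly_above.
rewrite {1}/indep_poly (bigID (fun I : {set T} => S \subset I)) /= addrC; congr (_ + _).
rewrite (partition_big (fun I : {set T} => I :\: S) (deletion ind S)) /=; last first.
  move=> I /andP[iI _]; rewrite /deletion disjoints_subset subsetDr.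
  exact: her (subsetDl _ _) iI.
rewrite /indep_poly big_distrl /=; apply: eq_bigr => J /andP[dJ iJ].
have -> : qpoly s = \sum_(A : {set T} | (A \subset S) && (A != S)) 'X^#|A|.
  rewrite /qpoly -cS -big_subset_Xn (bigID (pred1 S)) /=.
  rewrite (big_pred1 S) => [|A /=]; first by rewrite [X in X - _]addrC addrK.
  by case: eqP => [->|]; rewrite ?subxx ?andbF.
rewrite big_distrr /= (reindex_onto (fun A => J :|: A) (fun I => I :&: S)) /=; last first.
  by move=> I /andP[_ /eqP <-]; rewrite setUC setID.
have JS : J :&: S = set0 by apply: disjoint_setI0.
apply: eq_big => A.
  rewrite setIUl JS set0U setDUl; have -> : J :\: S = J.
    by apply/eqP; rewrite eqEsubset subsetDl subsetD subxx dJ.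
  rewrite (sameP eqP setIidPl).
  case: (boolP (A \subset S)) => AS; rewrite ?andbF //= andbT.
  have -> : A :\: S = set0 by apply/eqP; rewrite setD_eq0.
  rewrite setU0 eqxx andbT.
  have -> : (S \subset J :|: A) = (A == S).
    rewrite eqEsubset AS /=; apply/idP/idP => [SJA|SA].
      apply/subsetP => x xS; have := subsetP SJA x xS; rewrite inE.
      by rewrite (disjointFl dJ xS).
    exact: subset_trans SA (subsetUr _ _).
  apply: andb_idl => nAS.
  have [f fS fA] : exists2 f, f \in S & f \notin A.
    by apply/subsetPn; apply: contra nAS => SA; rewrite eqEsubset AS.
  apply: her (serS f J fS iJ dJ); apply: setUS; apply/subsetP => x xA.
  by rewrite in_setD1 (subsetP AS) // andbT; apply: contraNneq fA => <-.
move=> /andP[_ /eqP]; rewrite setIUl JS set0U => /setIidPl AS.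
by rewrite cardsU (disjoint_setI0 (disjointWr AS dJ)) cards0 subn0 exprD.
Qed.

Lemma indep_poly_cone (T : finType) (ind : pred {set T}) (r : nat) :
  coloop_free_matroid ind r -> alt_cone r (indep_poly ind).
Proof.
(* Induction on the number of non-loops: both minors turn [e] and its whole class into loops. *)
have [n] := ubnP #|[set x | ind [set x]]|; elim: n ind r => // n IHn ind r Hn M.
have i0 : ind set0 by have [B iB _] := ind_basis M; apply: (indS M _ iB); apply: sub0set.
have [e0|[e]] := set_0Vmem [set x | ind [set x]].
  have indE A : ind A = (A == set0).
    apply/idP/eqP => [iA|->//]; have [->//|[x xA]] := set_0Vmem A.
    suff: x \in [set x | ind [set x]] by rewrite e0 inE.
    by rewrite inE; apply: (indS M _ iA); rewrite sub1set.
  rewrite /indep_poly (big_pred1 set0) // cards0 expr0.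
  have [B iB <-] := ind_basis M.
  by move: iB; rewrite indE => /eqP ->; rewrite cards0; apply: alt_cone1.
rewrite inE => ie; set S := series_class ind r e.
have eS : e \in S by apply: series_class_id.
case cS: #|S| => [|s]; first by move: (cards0_eq cS) eS => ->; rewrite inE.
have [sr Md] := deletion_matroid M cS.
have lt (ind' : pred {set T}) : (forall x, ind' [set x] -> ind [set x] /\ x \notin S) ->
    (#|[set x | ind' [set x]]| < n)%N.
  move=> H; rewrite -ltnS; apply: leq_trans Hn; rewrite ltnS.
  apply: proper_card; apply/properP; split.
    by apply/subsetP => x; rewrite !inE => /H[].
  by exists e; rewrite inE //; apply/negP => /H[_]; rewrite eS.
rewrite (indep_poly_series (indS M) cS); last first.
  by move=> f J fS iJ dJ; apply: (series_class_ind M).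
apply: alt_coneD.
  rewrite -(subnK sr); apply/alt_coneM/IHn => //; apply: lt => x /andP[].
  by rewrite disjoints1.
(* If the class is dependent, the contraction has no independent set at all and its summand is
   zero. *)
have [iS|niS] := boolP (ind S); last first.
  rewrite /indep_poly big_pred0 ?mulr0; first exact/alt_cone_sym/sym_cone0.
  move=> J; apply: contraNF niS => /andP[_ iJS]; apply: (indS M _ iJS).
  exact: subsetUr.
have Sr : (s.+1 <= r)%N by rewrite -cS (ind_leq_rank M).
rewrite -{1}(subnKC Sr) -cS; apply/alt_coneXn/IHn; last exact: contraction_matroid.
apply: lt => x /andP[]; rewrite disjoints1 => xS ixS; split=> //.
by apply: (indS M _ ixS); apply: subsetUl.
Qed.

Lemma indep_poly_above_cone (T : finType) (ind : pred {set T}) (r : nat) (K : {set T}) :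
  coloop_free_matroid ind r -> ind K ->
  alt_cone r (\sum_(I : {set T} | ind I && (K \subset I)) 'X^#|I|).
Proof.
move=> M iK; rewrite indep_poly_above -(subnKC (ind_leq_rank M iK)).
exact/alt_coneXn/indep_poly_cone/contraction_matroid.
Qed.

(** * Increments of valuations *)

(** The Minkowski sum of [P] with the segment from 0 to [x]. *)
Definition thicken (R : realType) (d : nat) (P : set 'rV[R]_d) (x : 'rV[R]_d) :
    set 'rV[R]_d :=
  [set y | exists s p, [/\ 0 <= s <= 1, P p & y = p + s *: x]].

Definition family_cat (T : Type) (m : nat) (p q : 'I_m -> T) (i : 'I_(m + m)) : T :=
  match split i with inl j => p j | inr j => q j end.

Lemma split_lshift m n (i : 'I_m) : split (lshift n i) = inl i.
Proof. exact: (unsplitK (inl i)). Qed.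

Lemma split_rshift m n (i : 'I_n) : split (rshift m i) = inr i.
Proof. exact: (unsplitK (inr i)). Qed.

Lemma subrACA (V : zmodType) (a b c e : V) : (a - b) - (c - e) = (a - c) - (b - e).
Proof. by rewrite !opprB addrACA [RHS]addrACA [- b - c]addrC. Qed.

Section Geometry.
Local Open Scope classical_set_scope.
Local Open Scope ring_scope.
Variables (R : realType) (d : nat).
Implicit Types (P Q A B : set 'rV[R]_d).
Local Notation ip := (@lattice_pt R d).

Lemma lattice_ptD x y : ip (x + y) = ip x + ip y.
Proof. exact: map_mxD. Qed.

Lemma lattice_ptN x : ip (- x) = - ip x.
Proof. exact: map_mxN. Qed.

Lemma lattice_ptZ (a : int) x : ip (a *: x) = a%:~R *: ip x.
Proof. exact: map_mxZ. Qed.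

Lemma lattice_pt0 : ip 0 = 0.
Proof. exact: map_mx0. Qed.

Lemma lattice_pt_inj : injective ip.
Proof.
move=> x y /matrixP e; apply/matrixP => i j.
by have := e i j; rewrite !mxE => /intr_inj.
Qed.

Lemma convex_hull_catP m (p q : 'I_m -> 'rV[R]_d) y :
  convex_hull (family_cat p q) y <->
  exists l l' : 'I_m -> R, [/\ forall i, 0 <= l i, forall i, 0 <= l' i,
    \sum_i l i + \sum_i l' i = 1 & y = \sum_i l i *: p i + \sum_i l' i *: q i].
Proof.
split=> [[l [l0 l1 ->]]|[l [l' [l0 l0' l1 ->]]]].
  exists (fun i => l (lshift m i)), (fun i => l (rshift m i)); split=> //.
    by rewrite -l1 big_split_ord.
  rewrite big_split_ord /=; congr (_ + _); apply: eq_bigr => i _;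
  by rewrite /family_cat ?split_lshift ?split_rshift.
exists (family_cat l l'); split=> [i||].
- by rewrite /family_cat; case: split.
- rewrite big_split_ord /= -l1; congr (_ + _); apply: eq_bigr => i _;
  by rewrite /family_cat ?split_lshift ?split_rshift.
- rewrite big_split_ord /=; congr (_ + _); apply: eq_bigr => i _;
  by rewrite /family_cat ?split_lshift ?split_rshift.
Qed.

Lemma lattice_pt_cat m (p q : 'I_m -> 'rV[int]_d) :
  (fun i => ip (family_cat p q i)) = family_cat (fun i => ip (p i)) (fun i => ip (q i)).
Proof. by apply/funext => i; rewrite /family_cat; case: split. Qed.

Lemma lattice_polytope_segment P a x s t : lattice_polytope P ->
  P a -> P (a + t *: x) -> 0 <= s <= t -> P (a + s *: x).
Proof.
move=> [m [p ->]] [l [l0 l1 aE]] [k [k0 k1 bE]] /andP[s0 st].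
have [t0|t_neq0] := eqVneq t 0.
  have -> : s = 0 by lra.
  by rewrite scale0r addr0; exists l.
have t_gt0 : 0 < t by rewrite lt_def t_neq0 (le_trans s0).
have [r r01 rt] : exists2 r, 0 <= r <= 1 & r * t = s.
  exists (s / t); last by rewrite divfK.
  by rewrite ler_pdivrMr // mul1r st divr_ge0 // ltW.
exists (fun i => (1 - r) * l i + r * k i); split=> [i||].
- by rewrite addr_ge0 // mulr_ge0 ?l0 ?k0 //; lra.
- by rewrite big_split /= -!big_distrr /= l1 k1 !mulr1 subrK.
under eq_bigr do rewrite scalerDl -!scalerA.
rewrite big_split /= -!scaler_sumr -aE -bE scalerBl scale1r scalerDr.
by rewrite addrA subrK scalerA rt.
Qed.

Lemma lattice_polytope_point (x : 'rV[int]_d) : lattice_polytope [set ip x].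
Proof.
exists 1%N, (fun => x); apply/seteqP; split=> y /=.
  move=> ->; exists (fun => 1).
  by rewrite !big_ord1 scale1r; split.
by case=> l [_]; rewrite !big_ord1 => -> ->; rewrite scale1r.
Qed.

Lemma lattice_polytope_thicken P (x : 'rV[int]_d) :
  lattice_polytope P -> lattice_polytope (thicken P (ip x)).
Proof.
move=> [m [p ->]]; exists (m + m)%N, (family_cat p (fun i => p i + x)).
rewrite lattice_pt_cat; apply/seteqP; split=> y.
  move=> [s [_ [s01 [l [l0 l1 ->]] ->]]]; apply/convex_hull_catP.
  exists (fun i => (1 - s) * l i), (fun i => s * l i); split=> [i|i||].
  - by rewrite mulr_ge0 //; lra.
  - by rewrite mulr_ge0 //; lra.
  - by rewrite -!big_distrr /= l1; lra.
  rewrite -big_split /=.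
  under [RHS]eq_bigr => i _.
    rewrite lattice_ptD scalerDr addrA -scalerDl -mulrDl subrK mul1r mulrC -scalerA.
  over.
  by rewrite big_split /= -scaler_suml l1 scale1r.
move=> /convex_hull_catP[l [l' [l0 l0' l1 ->]]].
(* The position along the segment is the total weight on the shifted vertices. *)
exists (\sum_i l' i), (\sum_i (l i + l' i) *: ip (p i)); split.
- rewrite sumr_ge0 //= -l1 lerDr sumr_ge0 //.
- by exists (fun i => l i + l' i); split=> [i||//]; rewrite ?addr_ge0 // big_split.
rewrite scaler_suml -!big_split /=; apply: eq_bigr => i _.
by rewrite lattice_ptD scalerDr scalerDl addrA.
Qed.

Lemma lattice_polytope_translate P (x : 'rV[int]_d) :
  lattice_polytope P -> lattice_polytope (translate (ip x) P).
Proof.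
move=> [m [p ->]]; exists m, (fun i => p i + x); apply/seteqP; split=> y.
  move=> [_ [l [l0 l1 ->] <-]]; exists l; split=> //.
  under [RHS]eq_bigr do rewrite lattice_ptD scalerDr.
  by rewrite big_split /= -scaler_suml l1 scale1r.
move=> [l [l0 l1 ->]]; exists (\sum_i l i *: ip (p i)); first by exists l.
under [RHS]eq_bigr do rewrite lattice_ptD scalerDr.
by rewrite big_split /= -scaler_suml l1 scale1r.
Qed.

Lemma thickenC P x y : thicken (thicken P x) y = thicken (thicken P y) x.
Proof.
apply/seteqP; split=> z [s [_ [s01 [t [p [t01 Pp ->]] ->]]]].
  by exists t, (p + s *: y); split=> //; [exists s, p|rewrite addrAC].
by exists t, (p + s *: x); split=> //; [exists s, p|rewrite addrAC].
Qed.

Lemma thicken_translate P x y : thicken (translate x P) y = translate x (thicken P y).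
Proof.
apply/seteqP; split=> z.
  move=> [s [_ [s01 [p Pp <-] ->]]]; exists (p + s *: y); last by rewrite addrAC.
  by exists s, p.
move=> [_ [s [p [s01 Pp ->]]] <-]; exists s, (p + x); split=> //; last by rewrite addrAC.
by exists p.
Qed.

Lemma thickenN P x : translate x (thicken P (- x)) = thicken P x.
Proof.
apply/seteqP; split=> z.
  move=> [_ [s [p [s01 Pp ->]]] <-]; exists (1 - s), p; split=> //; first by lra.
  by rewrite scalerN scalerBl scale1r addrA addrAC.
move=> [s [p [s01 Pp ->]]]; exists (p + (1 - s) *: - x).
  by exists (1 - s), p; split=> //; lra.
by rewrite scalerN scalerBl scale1r opprB addrA subrK.
Qed.

Lemma thickenDn P x n :
  thicken (thicken P (n%:R *: x)) x = thicken P (n.+1%:R *: x).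
Proof.
have n1_gt0 : 0 < n.+1%:R :> R by rewrite ltr0n.
apply/seteqP; split=> z.
  move=> [s [_ [s01 [t [p [t01 Pp ->]] ->]]]].
  exists ((t * n%:R + s) / n.+1%:R), p; split=> //; last first.
    by rewrite [in RHS]scalerA divfK ?gt_eqF // scalerDl -scalerA addrA.
  have n0 : 0 <= n%:R :> R by rewrite ler0n.
  apply/andP; split.
    by rewrite divr_ge0 ?(ltW n1_gt0) // addr_ge0 ?mulr_ge0 //; lra.
  by rewrite ler_pdivrMr // mul1r -natr1; apply: lerD; [nra|lra].
move=> [s [p [s01 Pp ->]]]; exists s, (p + s *: (n%:R *: x)); split=> //.
  by exists s, p.
by rewrite -natr1 scalerDl scale1r scalerDr addrA.
Qed.

Lemma thicken0 P : thicken P 0 = P.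
Proof.
apply/seteqP; split=> z; first by move=> [s [p [_ Pp ->]]]; rewrite scaler0 addr0.
by move=> Pz; exists 0, z; split=> //; [rewrite lexx ler01|rewrite scaler0 addr0].
Qed.

Variable G : zmodType.
Implicit Types phi : set 'rV[R]_d -> G.

(* The class of functionals through which the induction runs. [segment_slide]
   says that the increment [phi (A + [0,x]) - phi A] only depends on the
   projection of [A] along [x]; unlike the valuation property, it is inherited
   by these increments without a topological argument. *)
Record sliding phi : Prop := Sliding {
  slide_translate : forall P (x : 'rV[int]_d),
    lattice_polytope P -> phi (translate (ip x) P) = phi P;
  segment_slide : forall A B (x : 'rV[int]_d),
    lattice_polytope A -> lattice_polytope B -> B `<=` A ->
    (forall a, A a -> exists2 s, 0 <= s & B (a + s *: ip x)) ->
    phi (thicken A (ip x)) - phi A = phi (thicken B (ip x)) - phi B }.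

Lemma valuation_sliding phi : Zd_valuation phi -> sliding phi.
Proof.
move=> [_ phiU phiT]; split=> [P x hP|A B x hA hB BA AB]; first exact: phiT.
have hBx := lattice_polytope_thicken x hB.
have UE : A `|` thicken B (ip x) = thicken A (ip x).
  apply/seteqP; split=> y.
    case=> [Ay|[s [b [s01 Bb ->]]]]; last by exists s, b; split=> //; apply: BA.
    exists 0, y; split=> //; first by rewrite lexx ler01.
    by rewrite scale0r addr0.
  move=> [s [a [/andP[s0 s1] Aa ->]]]; have [t t0 Bat] := AB a Aa.
  (* Before [B] is reached the point is still in [A] by convexity; afterwards it is in B + [0,x],
     because s - t is at most 1. *)
  have [st|ts] := leP s t; [left|right].
    by apply: (lattice_polytope_segment hA Aa (BA _ Bat)); rewrite s0.
  exists (s - t), (a + t *: ip x); split=> //; first by lra.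
  by rewrite -addrA -scalerDl subrKC.
(* A point b + sx of [A] slides on into [B], so it lies between two points of the convex set [B]. *)
have IE : A `&` thicken B (ip x) = B.
  apply/seteqP; split=> y.
    move=> [Ay [s [b [/andP[s0 s1] Bb yE]]]]; have [t t0 Byt] := AB y Ay.
    rewrite yE; apply: (lattice_polytope_segment hB Bb (t := s + t)); last first.
      by rewrite s0 lerDl.
    by rewrite scalerDl addrA -yE.
  move=> By; split; first exact: BA.
  by exists 0, y; split=> //; [rewrite lexx ler01|rewrite scale0r addr0].
have := phiU A (thicken B (ip x)) hA hBx.
rewrite UE IE => -> //; last exact: lattice_polytope_thicken.
by rewrite addrAC [phi A + _]addrC addrK addrC.
Qed.

Definition increment phi (x : 'rV[int]_d) P : G := phi (thicken P (ip x)) - phi P.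

(** The sliding hypothesis passes from A, B to A + [0,y], B + [0,y], and a second difference may be
    taken in either order. *)
Lemma increment_sliding phi y : sliding phi -> sliding (increment phi y).
Proof.
move=> [phiT phiS]; split=> [P x hP|A B x hA hB BA AB].
  rewrite /increment thicken_translate !phiT //; exact: lattice_polytope_thicken.
have e1 := phiS _ _ x (lattice_polytope_thicken y hA) (lattice_polytope_thicken y hB).
have e2 := phiS _ _ x hA hB BA AB.
rewrite /increment subrACA [RHS]subrACA e2; congr (_ - _).
rewrite (thickenC A) (thickenC B) e1 // => z [s [p [s01 Ap ->]]].
  by exists s, p; split=> //; apply: BA.
have [t t0 Bp] := AB p Ap; exists t => //; exists s, (p + t *: ip x).
by rewrite addrAC.
Qed.

(** Each further step adds the increment of Q = P + [0,nx], which equals that of [P], as [Q] slides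
    along x onto the translate P + nx. *)
Lemma increment_muln phi P x n : sliding phi -> lattice_polytope P ->
  phi (thicken P (ip (x *+ n))) - phi P = increment phi x P *+ n.
Proof.
move=> S hP.
have ipn k : ip (x *+ k) = k%:R *: ip x by rewrite -scaler_nat lattice_ptZ natz.
elim: n => [|n IHn].
  by rewrite !mulr0n lattice_pt0 thicken0 subrr.
rewrite [RHS]mulrSr -IHn ipn -thickenDn -ipn.
have hQ := lattice_polytope_thicken (x *+ n) hP.
set Q := thicken P _ in hQ *.
suff -> : increment phi x P = increment phi x Q.
  by rewrite /increment [RHS]addrC addrA subrK.
rewrite -(slide_translate (increment_sliding x S) (x *+ n) hP).
apply: esym; apply: (segment_slide S) => //; first exact: lattice_polytope_translate.
  move=> _ [p Pp <-]; exists 1, p; split=> //; first by rewrite ler01 lexx.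
  by rewrite scale1r.
move=> _ [s [p [/andP[s0 s1] Pp ->]]]; exists ((1 - s) * n%:R).
  by rewrite mulr_ge0 //; lra.
exists p => //; rewrite ipn -scalerA -addrA -scalerDl subrKC scale1r //.
Qed.

(** Let [Q] be a copy of the projection, translated along [x] until it lies beyond [P]. The convex
    hull [U] of both slides along [x] onto [Q] and along [-x] onto [P], and increments along [x] and
    [-x] agree. The projection matrix is integral, so [Q] is a lattice polytope. *)
Lemma increment_projection phi (u : 'cV[int]_d) (x0 : 'rV[int]_d) (g : int) P :
  sliding phi -> lattice_polytope P -> g != 0 ->
  increment phi (g *: x0)
    [set y *m (1%:M - map_mx intr (u *m x0)) | y in P] =
  increment phi (g *: x0) P.
Proof.
move=> S [m [p PE]] g0; have hP : lattice_polytope P by exists m, p.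
set x := g *: x0; pose M : 'M[int]_d := 1%:M - u *m x0.
have -> : 1%:M - map_mx intr (u *m x0) = map_mx intr M :> 'M[R]_d.
  by rewrite map_mxB map_mx1.
(* The multiple of [x] by which the projected copy of [P] lies above [P]. *)
pose N := \sum_i `|(p i *m u) 0 0|.
pose q i := p i *m M + N *: x.
(* The distance, in multiples of [x], from vertex [p i] to [q i]; it is nonnegative because [N]
   dominates every coordinate and |g| is at least 1. *)
pose s i : R := N%:~R - ((p i *m u) 0 0)%:~R / g%:~R.
have g1 : 1 <= `|g%:~R| :> R.
  by rewrite -intr_norm ler1z; move: g0; lia.
have s0 i : 0 <= s i.
  rewrite subr_ge0 (le_trans (ler_norm _)) // normrM normfV.
  rewrite (@le_trans _ _ `|((p i *m u) 0 0)%:~R|) //.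
    by rewrite ler_pdivrMr ?ler_peMr // (lt_le_trans ltr01).
  rewrite -intr_norm ler_int /N (bigD1 i) //= lerDl.
  by apply: sumr_ge0 => ? _; apply: normr_ge0.
have qE i : ip (q i) = ip (p i) + s i *: ip x.
  rewrite /q /M mulmxBr mulmx1 mulmxA [p i *m u]mx11_scalar mul_scalar_mx.
  rewrite !lattice_ptD lattice_ptN (lattice_ptZ _ x) (lattice_ptZ _ x0).
  rewrite /s scalerBl -addrA.
  congr (_ + _); rewrite addrC; congr (_ - _).
  rewrite lattice_ptZ scalerA divfK //.
  by apply: contraTneq g1 => ->; rewrite normr0 ler10.
pose Q := convex_hull (fun i => ip (q i)).
pose U := convex_hull (fun i => ip (family_cat p q i)).
have hQ : lattice_polytope Q by exists m, q.
have hU : lattice_polytope U by exists (m + m)%N, (family_cat p q).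
have QE : Q = translate (ip (N *: x)) [set y *m map_mx intr M | y in P].
  have qE' i : ip (q i) = ip (p i) *m map_mx intr M + ip (N *: x).
    by rewrite /q lattice_ptD /lattice_pt map_mxM.
  rewrite PE; apply/seteqP; split=> y.
    move=> [l [l0 l1 ->]]; exists ((\sum_i l i *: ip (p i)) *m map_mx intr M).
      by exists (\sum_i l i *: ip (p i)) => //; exists l.
    under [RHS]eq_bigr do rewrite qE' scalerDr scalemxAl.
    by rewrite big_split /= -scaler_suml l1 scale1r mulmx_suml.
  move=> [_ [_ [l [l0 l1 ->]] <-] <-]; exists l; split=> //.
  under [RHS]eq_bigr do rewrite qE' scalerDr scalemxAl.
  by rewrite big_split /= -scaler_suml l1 scale1r mulmx_suml.
have zeros (f : 'I_m -> 'rV[R]_d) : \sum_i (fun=> 0 : R) i *: f i = 0.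
  by apply: big1 => i _; rewrite scale0r.
have QU : Q `<=` U.
  move=> y [l [l0 l1 ->]]; rewrite /U lattice_pt_cat; apply/convex_hull_catP.
  by exists (fun=> 0), l; rewrite zeros big1 // !add0r.
have PU : P `<=` U.
  move=> y; rewrite PE => -[l [l0 l1 ->]]; rewrite /U lattice_pt_cat.
  apply/convex_hull_catP; exists l, (fun=> 0).
  by rewrite zeros [X in _ + X]big1 // !addr0.
have e1 : increment phi x U = increment phi x Q.
  apply: (segment_slide S) => // a.
  rewrite /U lattice_pt_cat => /convex_hull_catP[l [l' [l0 l0' l1 ->]]].
  exists (\sum_i l i * s i); first by apply: sumr_ge0 => i _; apply: mulr_ge0.
  exists (fun i => l i + l' i); split=> [i||]; first exact: addr_ge0.
    by rewrite big_split.
  rewrite addrAC scaler_suml -!big_split /=; apply: eq_bigr => i _.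
  by rewrite -scalerA -scalerDr -qE -scalerDl.
have e2 : increment phi (- x) U = increment phi (- x) P.
  apply: (segment_slide S) => // a.
  rewrite /U lattice_pt_cat => /convex_hull_catP[l [l' [l0 l0' l1 ->]]].
  exists (\sum_i l' i * s i); first by apply: sumr_ge0 => i _; apply: mulr_ge0.
  rewrite PE; exists (fun i => l i + l' i); split=> [i||]; first exact: addr_ge0.
    by rewrite big_split.
  rewrite lattice_ptN scalerN scaler_suml -sumrN -!big_split /=; apply: eq_bigr => i _.
  by rewrite scalerDl qE !scalerDr scalerA addrA addrK.
have opp A : lattice_polytope A -> increment phi (- x) A = increment phi x A.
  move=> hA; rewrite /increment -[in RHS]thickenN -lattice_ptN slide_translate //.
  exact: lattice_polytope_thicken.
have hM : lattice_polytope [set y *m map_mx intr M | y in P].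
  exists m, (fun i => p i *m M); rewrite PE; apply/seteqP; split=> y.
    move=> [_ [l [l0 l1 ->]] <-]; exists l; split=> //.
    by rewrite mulmx_suml; apply: eq_bigr => i _; rewrite -scalemxAl /lattice_pt map_mxM.
  move=> [l [l0 l1 ->]]; exists (\sum_i l i *: ip (p i)); first by exists l.
  by rewrite mulmx_suml; apply: eq_bigr => i _; rewrite -scalemxAl /lattice_pt map_mxM.
rewrite -(slide_translate (increment_sliding x S) (N *: x) hM) -QE -e1.
by rewrite -opp // e2 opp.
Qed.

End Geometry.

(** * Zonotopes *)

(** From the Smith normal form of a single row: [x0] is the first row of a unimodular matrix and [u]
    the first column of its inverse. Thus 1 - u x0 is an integral projection that kills [x]. *)
Lemma primitive_row (d : nat) (x : 'rV[int]_d) : x != 0 ->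
  exists (g : int) (x0 : 'rV[int]_d) (u : 'cV[int]_d),
    [/\ g != 0, x = g *: x0 & x0 *m u = 1%:M].
Proof.
case: d x => [|d] x x0; first by rewrite thinmx0 eqxx in x0.
have [L _ [M uM [e _ xE]]] := int_Smith_normal_form x.
exists (L 0 0 * e`_0), (row 0 M), (col 0 (invmx M)).
have xE' : x = (L 0 0 * e`_0) *: row 0 M.
  rewrite xE [L]mx11_scalar mul_scalar_mx -scalemxAl -scalerA; congr (_ *: _).
    by rewrite mxE eqxx.
  apply/rowP => j; rewrite !mxE (bigD1 0) //= big1 ?addr0 => [|i i0].
    by rewrite !mxE eqxx.
  by rewrite !mxE eq_sym -val_eqE /= in i0 *; rewrite (negPf i0) mulr0n mul0r.
split=> //; first by apply: contra_neq x0 => g0; rewrite xE' g0 scale0r.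
rewrite rowE colE mulmxA mulmxK // mul_delta_mx.
by apply/matrixP => i j; rewrite !mxE !ord1.
Qed.

(** * Möbius inversion over the subsets of a finite set *)

Section Mobius.
Variables (T : finType) (G : zmodType).
Implicit Types (F : {set T} -> G) (I L : {set T}).

Definition mobius F I : G := \sum_(L : {set T} | L \subset I) F L *~ (-1) ^+ #|I :\: L|.

Lemma eq_mobius F F' I : (forall L : {set T}, L \subset I -> F L = F' L) ->
  mobius F I = mobius F' I.
Proof. by move=> e; apply: eq_bigr => L LI; rewrite e. Qed.

Lemma mobius_setD1 F I x : x \in I ->
  mobius F I = mobius (fun L => F (x |: L) - F L) (I :\ x).
Proof.
move=> xI; rewrite /mobius (big_subset_setD1 _ xI); apply: eq_bigr => L.
rewrite subsetD1 => /andP[LI xL].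
have -> : I :\: (x |: L) = I :\ x :\: L by rewrite setDDl.
have -> : #|I :\: L| = #|I :\ x :\: L|.+1.
  rewrite (cardsD1 x) in_setD xL xI; congr (_.+1); congr #|pred_of_set _|.
  by rewrite !setDDl setUC.
by rewrite exprS mulN1r mulrNz mulrzBl addrC.
Qed.

Lemma mobius_inversion F I : F I = \sum_(L : {set T} | L \subset I) mobius F L.
Proof.
have [n] := ubnP #|I|; elim: n F I => // n IHn F I In.
have [->|[x xI]] := set_0Vmem I.
  rewrite (big_pred1 set0) => [|L]; last by rewrite subset0.
  rewrite /mobius (big_pred1 set0) => [|L]; last by rewrite subset0.
  by rewrite setD0 cards0 expr0.
have In' : (#|I :\ x| < n)%N by move: In; rewrite (cardsD1 x) xI.
rewrite (big_subset_setD1 _ xI) big_split /= -IHn //.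
transitivity (F (I :\ x) + (F (x |: I :\ x) - F (I :\ x))).
  by rewrite setD1K // subrKC.
congr (_ + _); rewrite (IHn (fun L => F (x |: L) - F L)) //.
apply: eq_bigr => L; rewrite subsetD1 => /andP[_ xL].
by rewrite (mobius_setD1 F (setU11 x L)) setU1K.
Qed.

Lemma mobiusMn F I n : mobius (fun L => F L *+ n) I = mobius F I *+ n.
Proof. by rewrite -sumrMnl; apply: eq_bigr => L _; rewrite !pmulrn mulrzAC. Qed.

Lemma mobius_cst0 I : mobius (fun=> 0) I = 0.
Proof. by apply: big1 => L _; rewrite mul0rz. Qed.

End Mobius.

(** * Values on half-open parallelepipeds *)

Section Zonotopes.
Local Open Scope classical_set_scope.
Local Open Scope ring_scope.
Variables (R : realType) (d : nat) (T : finType).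
Implicit Types (I L : {set T}).
Local Notation ip := (@lattice_pt R d).

Definition partial_zonotope (v : T -> 'rV[R]_d) (I : {set T}) : set 'rV[R]_d :=
  [set x | exists l : T -> R,
     (forall i, 0 <= l i <= 1) /\ x = \sum_(i in I) l i *: v i].

Lemma partial_zonotope0 v : partial_zonotope v set0 = [set 0].
Proof.
apply/seteqP; split=> x /=; first by move=> [l [_ ->]]; rewrite big_set0.
by move=> ->; exists (fun=> 0); rewrite big_set0 lexx ler01; split.
Qed.

Lemma partial_zonotopeU1 v I i : i \notin I ->
  partial_zonotope v (i |: I) = thicken (partial_zonotope v I) (v i).
Proof.
move=> iI; apply/seteqP; split=> x.
  move=> [l [l01 ->]]; exists (l i), (\sum_(j in I) l j *: v j).
  by split=> //; [exists l|rewrite big_setU1 //= addrC].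
move=> [s [_ [s01 [l [l01 ->]] ->]]].
exists (fun j => if j == i then s else l j); split=> [j|]; first by case: ifP.
rewrite big_setU1 //= eqxx addrC; congr (_ + _); apply: eq_bigr => j jI.
by case: eqP jI iI => // -> ->.
Qed.

Lemma partial_zonotope_mulmx v I (M : 'M[R]_d) :
  partial_zonotope (fun i => v i *m M) I = [set y *m M | y in partial_zonotope v I].
Proof.
apply/seteqP; split=> x.
  move=> [l [l01 ->]]; exists (\sum_(i in I) l i *: v i); first by exists l.
  by rewrite mulmx_suml; apply: eq_bigr => i _; rewrite scalemxAl.
move=> [_ [l [l01 ->]] <-]; exists l; split=> //.
by rewrite mulmx_suml; apply: eq_bigr => i _; rewrite scalemxAl.
Qed.

Lemma partial_zonotope_lattice (v : T -> 'rV[int]_d) I :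
  lattice_polytope (partial_zonotope (fun i => ip (v i)) I).
Proof.
have [n] := ubnP #|I|; elim: n I => // n IHn I In.
have [->|[x xI]] := set_0Vmem I.
  by rewrite partial_zonotope0 -(@lattice_pt0 R d); apply: lattice_polytope_point.
rewrite -(setD1K xI) partial_zonotopeU1 ?setD11 //.
by apply/lattice_polytope_thicken/IHn; move: In; rewrite (cardsD1 x) xI.
Qed.

Lemma dilate_partial_zonotope (v : T -> 'rV[int]_d) I k :
  dilate k (partial_zonotope (fun i => ip (v i)) I) =
  partial_zonotope (fun i => ip (v i *+ k)) I.
Proof.
have vk i : ip (v i *+ k) = k%:R *: ip (v i) by rewrite -scaler_nat lattice_ptZ natz.
apply/seteqP; split=> x.
  move=> [_ [l [l01 ->]] <-]; exists l; split=> //; rewrite scaler_sumr.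
  by apply: eq_bigr => i _; rewrite vk !scalerA mulrC.
move=> [l [l01 ->]]; exists (\sum_(i in I) l i *: ip (v i)); first by exists l.
by rewrite scaler_sumr; apply: eq_bigr => i _; rewrite vk !scalerA mulrC.
Qed.

Variable G : zmodType.
Implicit Types phi : set 'rV[R]_d -> G.

(* The value of the extension of [phi] on the half-open parallelepiped
   spanned by the [v i], [i \in I]. *)
Definition half_open_value phi (v : T -> 'rV[int]_d) (I : {set T}) : G :=
  mobius (fun L => phi (partial_zonotope (fun i => ip (v i)) L)) I.

Lemma half_open_value_setD1 phi v I i : i \in I ->
  half_open_value phi v I = half_open_value (increment phi (v i)) v (I :\ i).
Proof.
move=> iI; rewrite /half_open_value (mobius_setD1 _ iI); apply: eq_mobius => L.
by rewrite subsetD1 => /andP[_ iL]; rewrite partial_zonotopeU1.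
Qed.

(** Generators are peeled off one at a time, each contributing a factor k by [increment_muln];
    geometrically, the dilated half-open parallelepiped is tiled by k^|I| translates. *)
Lemma half_open_value_mulrn phi v I k : sliding phi ->
  half_open_value phi (fun i => v i *+ k) I =
  half_open_value phi v I *+ (k ^ #|I|).
Proof.
have [n] := ubnP #|I|; elim: n phi I => // n IHn phi I In S.
have [->|[i iI]] := set_0Vmem I.
  rewrite cards0 expn0 mulr1n; apply: eq_mobius => L; rewrite subset0 => /eqP ->.
  by rewrite !partial_zonotope0.
have cI : #|I| = #|I :\ i|.+1 by rewrite (cardsD1 i) iI.
rewrite !(half_open_value_setD1 _ _ iI) cI expnS mulrnA.
transitivity (half_open_value (increment phi (v i)) (fun i => v i *+ k) (I :\ i) *+ k).
  rewrite /half_open_value -mobiusMn; apply: eq_mobius => L _.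
  by rewrite {1}/increment increment_muln //; apply: partial_zonotope_lattice.
rewrite IHn; [by rewrite mulrnAC|by rewrite -ltnS -cI|exact: increment_sliding].
Qed.

(** The increment along [v i] sees only projections along [v i], so the remaining generators may be
    replaced by their projections, which inherit the linear relation. The induction stops at a zero
    generator, whose increment vanishes. *)
Lemma half_open_value_dependent phi v I (a : T -> R) : sliding phi ->
  (exists2 i, i \in I & a i != 0) -> \sum_(i in I) a i *: ip (v i) = 0 ->
  half_open_value phi v I = 0.
Proof.
have [n] := ubnP #|I|; elim: n phi v I => // n IHn phi v I In S [i iI ai0] aE.
have cI : #|I| = #|I :\ i|.+1 by rewrite (cardsD1 i) iI.
rewrite (half_open_value_setD1 _ _ iI).
have [vi0|vi0] := eqVneq (v i) 0.
  rewrite -(mobius_cst0 G (I :\ i)); apply: eq_mobius => L _.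
  by rewrite /increment vi0 lattice_pt0 thicken0 subrr.
have [g [x [u [g0 viE xu]]]] := primitive_row vi0.
pose M : 'M[int]_d := 1%:M - u *m x.
have MR : map_mx intr M = 1%:M - map_mx intr (u *m x) :> 'M[R]_d.
  by rewrite map_mxB map_mx1.
have vM j : ip (v j *m M) = ip (v j) *m map_mx intr M by rewrite /lattice_pt map_mxM.
have viM : ip (v i) *m map_mx intr M = 0.
  rewrite -vM viE /M mulmxBr mulmx1 -scalemxAl mulmxA xu mul1mx subrr.
  exact: lattice_pt0.
transitivity (half_open_value (increment phi (v i)) (fun j => v j *m M) (I :\ i)).
  apply: eq_mobius => L _.
  rewrite viE -(increment_projection u x S (partial_zonotope_lattice v L) g0) -MR.
  rewrite -partial_zonotope_mulmx; congr (increment _ _ (partial_zonotope _ _)).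
  by apply/funext => j; rewrite vM.
apply: IHn; [by rewrite -ltnS -cI|exact: increment_sliding| |].
  (* Another coefficient must be nonzero, or the relation would force [v i] to vanish. *)
  apply: contrapT => na.
  move: aE; rewrite (big_setD1 i) //= big1 ?addr0 => [|j jI]; last first.
    have [->|aj] := eqVneq (a j) 0; first by rewrite scale0r.
    by case: na; exists j.
  move/eqP; rewrite scaler_eq0 (negPf ai0) /= => /eqP vi.
  by move: vi0; rewrite -(inj_eq (@lattice_pt_inj R d)) vi lattice_pt0 eqxx.
move: aE => /(congr1 (mulmx^~ (map_mx intr M))); rewrite mul0mx mulmx_suml.
rewrite (big_setD1 i) //= -scalemxAl viM scaler0 add0r => aE; rewrite -[RHS]aE.
by apply: eq_bigr => j _; rewrite vM scalemxAl.
Qed.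

End Zonotopes.

(** * Linear matroids and dimensions *)

Lemma order_compatibleD (G : porderZmodType) (x y z t : G) : order_compatible G ->
  x <= y -> z <= t -> x + z <= y + t.
Proof.
move=> comp xy zt; apply: le_trans (comp _ _ x zt) _.
by rewrite addrC [y + t]addrC; apply: comp.
Qed.

Lemma order_compatible_mulrz (G : porderZmodType) (x : G) (a b : int) :
  order_compatible G -> 0 <= x -> a <= b -> x *~ a <= x *~ b.
Proof.
move=> comp x0 ab; have -> : b = a + `|b - a|%N by lia.
rewrite mulrzDr -[X in X <= _]addr0; apply: (comp).
elim: `|b - a|%N => // k IHk; rewrite -pmulrn mulrS -[X in X <= _]addr0.
exact: (order_compatibleD comp x0 IHk).
Qed.

Section LinearMatroid.
Variables (R : realType) (d n : nat) (v : 'I_n -> 'rV[R]_d).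
Implicit Types I K : {set 'I_n}.

Definition span_on I : {vspace 'rV[R]_d} := <<[seq v i | i in I]>>%VS.

Lemma span_on_mem I i : i \in I -> v i \in span_on I.
Proof. by move=> iI; apply: memv_span; apply: image_f. Qed.

Lemma dim_rV_leq (U : {vspace 'rV[R]_d}) : (\dim U <= d)%N.
Proof.
by apply: leq_trans (dimvS (subvf U)) _; rewrite dimvf dim_matrix mul1r.
Qed.

Lemma span_onU1 I i : span_on (i |: I) = (<[v i]> + span_on I)%VS.
Proof.
rewrite /span_on -span_cons; apply: eq_span => x; rewrite inE.
apply/imageP/orP => [[j + ->]|[/eqP ->|/imageP[j jI ->]]].
- by rewrite in_setU1 => /orP[/eqP ->|jI]; [left|right; apply: image_f].
- by exists i; rewrite ?setU11.
- by exists j; rewrite ?in_setU1 ?jI ?orbT.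
Qed.

Lemma lin_indepU1 I i : i \notin I ->
  lin_indep v (i |: I) = (v i \notin span_on I) && lin_indep v I.
Proof.
move=> iI; rewrite /lin_indep -free_cons; apply: perm_free.
rewrite -[v i :: _]/(map v (i :: enum I)); apply: perm_map.
apply: uniq_perm; rewrite /= ?enum_uniq ?mem_enum ?iI //.
by move=> j; rewrite inE !mem_enum in_setU1.
Qed.

Lemma lin_indepS I K : I \subset K -> lin_indep v K -> lin_indep v I.
Proof.
move=> IK; rewrite /lin_indep => fK.
have e : perm_eq (enum K) (enum I ++ enum (K :\: I)).
  apply: uniq_perm; rewrite ?cat_uniq ?enum_uniq //= ?andbT.
    by apply/hasPn => j /=; rewrite !mem_enum in_setD => /andP[].
  move=> j; rewrite mem_cat !mem_enum in_setD.
  by have := subsetP IK j; case: (j \in I) => // /(_ isT).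
by move: fK; rewrite (perm_free (perm_map v e)) map_cat => /catl_free.
Qed.

Lemma lin_indep_dim I : lin_indep v I -> \dim (span_on I) = #|I|.
Proof. by move=> /eqP; rewrite size_image. Qed.

Lemma dim_span_on I : (\dim (span_on I) <= #|I|)%N.
Proof. by rewrite -(size_image v); apply: dim_span. Qed.

Lemma span_on_sub I (U : {vspace 'rV[R]_d}) :
  (forall i, i \in I -> v i \in U) -> (span_on I <= U)%VS.
Proof. by move=> H; apply/span_subvP => _ /imageP[i iI ->]; apply: H. Qed.

Lemma lin_indep0 : lin_indep v set0.
Proof. by rewrite /lin_indep /image_mem enum_set0 nil_free. Qed.

Lemma span_onP I x : x \in span_on I -> exists a, x = \sum_(i in I) a i *: v i.
Proof.
have [m] := ubnP #|I|; elim: m I x => // m IHm I x Im.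
have [->|[i iI]] := set_0Vmem I.
  rewrite /span_on /image_mem enum_set0 span_nil memv0 => /eqP ->.
  by exists (fun=> 0); rewrite big_set0.
rewrite -(setD1K iI) span_onU1 => /memv_addP[_ /vlineP[k ->] [y yS ->]].
have [|a ->] := IHm _ _ _ yS; first by move: Im; rewrite (cardsD1 i) iI.
exists (fun j => if j == i then k else a j).
rewrite big_setU1 ?setD11 //= eqxx; congr (_ + _); apply: eq_bigr => j.
by rewrite in_setD1 => /andP[/negPf ->].
Qed.

Lemma lin_dependentP I : ~~ lin_indep v I ->
  exists2 a : 'I_n -> R, (exists2 i, i \in I & a i != 0) & \sum_(i in I) a i *: v i = 0.
Proof.
have [m] := ubnP #|I|; elim: m I => // m IHm I Im.
have [->|[i iI]] := set_0Vmem I; first by rewrite lin_indep0.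
rewrite -(setD1K iI) lin_indepU1 ?setD11 // negb_and negbK => /orP[/span_onP[a vE]|].
  exists (fun j => if j == i then -1 else a j).
    by exists i; rewrite ?setU11 // eqxx oppr_eq0 oner_neq0.
  rewrite big_setU1 ?setD11 //= eqxx scaleN1r vE addrC; apply/eqP; rewrite subr_eq0.
  apply/eqP/eq_bigr => j.
  by rewrite in_setD1 => /andP[/negPf ->].
move/IHm => [|a [j jI aj] aE]; first by move: Im; rewrite (cardsD1 i) iI.
exists (fun k => if k == i then 0 else a k).
  exists j; first by rewrite in_setU1 jI orbT.
  by move: jI; rewrite in_setD1 => /andP[/negPf ->].
rewrite big_setU1 ?setD11 //= eqxx scale0r add0r -[RHS]aE; apply: eq_bigr => k.
by rewrite in_setD1 => /andP[/negPf ->].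
Qed.

(** Since the vectors span, the maximal independent sets are those of size d; this turns
    [coloop_free] into [ind_avoid]. Augmentation is a comparison of dimensions of spans. *)
Lemma lin_indep_matroid : spanning v -> coloop_free v ->
  coloop_free_matroid (lin_indep v) d.
Proof.
move=> sv cf.
have maxd I : maxset (lin_indep v) I -> lin_indep v I /\ #|I| = d.
  move=> /maxsetP[iI Imax]; split=> //.
  have full : span_on I = fullv.
    apply/eqP; rewrite eqEsubv subvf -[X in (X <= _)%VS]sv.
    apply/span_subvP => _ /imageP[i _ ->].
    have [iI'|iI'] := boolP (i \in I); first exact: span_on_mem.
    apply/negPn/negP => vi; have := Imax (i |: I).
    rewrite lin_indepU1 // vi iI => /(_ isT (subsetUr _ _)) e.
    by move: iI'; rewrite -e setU11.
  by rewrite -(lin_indep_dim iI) full dimvf dim_matrix mul1r.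
split.
- exact: lin_indepS.
- move=> I K iI iK IK; apply: contrapT => H; move: IK; rewrite ltnNge => /negP[].
  rewrite -(lin_indep_dim iI) -(lin_indep_dim iK); apply/dimvS/span_on_sub => x xK.
  have [xI|xI] := boolP (x \in I); first exact: span_on_mem.
  apply/negPn/negP => vx; apply: H; exists x; split=> //.
  by rewrite lin_indepU1 // vx.
- by move=> I /lin_indep_dim <-; apply: dim_rV_leq.
- have [I /maxd[iI cI] _] := maxset_exists lin_indep0.
  by exists I.
- move=> x; apply: contrapT => H; apply: (cf x) => I /maxd[iI cI].
  by apply/negPn/negP => xI; apply: H; exists I.
Qed.

(** Differences of points stay in the span, which bounds the dimension above; the origin and the
    generators in [K] attain the bound. It serves both the parallelepipeds (I = K) and the whole
    zonotope. *)
Lemma polytope_dim_zonotope I K : K \subset I -> lin_indep v K ->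
  (\dim (span_on I) <= #|K|)%N -> polytope_dim (partial_zonotope v I) = #|K|.
Proof.
move=> KI iK dimI; apply/eqP; rewrite eqn_leq; apply/andP; split.
  apply/bigmax_leqP => r /asboolP[p [pI fp]].
  apply: leq_trans dimI; move: fp; rewrite /affinely_independent => /eqP.
  rewrite size_image card_ord => <-; apply/dimvS/span_subvP => _ /imageP[i _ ->].
  have inI j : p j \in span_on I.
    have [l [_ ->]] := pI j; apply: memv_suml => k kI.
    exact/memvZ/span_on_mem.
  by rewrite memvB.
have Kd : (#|K| < d.+1)%N by rewrite ltnS -(lin_indep_dim iK) dim_rV_leq.
apply: (@leq_bigmax_cond _ _ (fun r : 'I_d.+1 => r : nat) (Ordinal Kd)).
apply/asboolP => /=.
exists (fun i => if unlift ord0 i is Some j then v (enum_val j) else 0); split.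
  move=> i; case: unliftP => [j _|_].
    exists (fun k => (k == enum_val j)%:R); split=> [k|].
      by case: eqP; rewrite ?lexx ler01.
    rewrite (bigD1 (enum_val j)) /=; last exact: (subsetP KI) (enum_valP j).
    rewrite eqxx scale1r big1 ?addr0 // => k /andP[_ /negPf ->].
    by rewrite scale0r.
  exists (fun=> 0); split=> [k|]; first by rewrite lexx ler01.
  by rewrite big1 // => k _; rewrite scale0r.
rewrite /affinely_independent unlift_none.
suff -> : [seq (if unlift ord0 (lift ord0 i) is Some j then v (enum_val j) else 0) - 0
    | i : 'I_#|K|] = [seq v i | i in K] by [].
apply: (@eq_from_nth _ 0) => [|i]; first by rewrite !size_image card_ord.
rewrite size_image card_ord => iK'.
rewrite -[i]/(val (Ordinal iK')) nth_image.
rewrite (nth_map (Ordinal iK')) ?size_enum_ord // nth_ord_enum liftK subr0 //.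
Qed.

End LinearMatroid.

(** * The h-vector of a zonotope in terms of half-open values *)

Section Assembly.
Variables (R : realType) (d n : nat) (v : 'I_n -> 'rV[int]_d).
Variables (G : porderZmodType) (phi : set 'rV[R]_d -> G).
Local Notation w := (fun i => lattice_pt R (v i)).
Implicit Types I K : {set 'I_n}.

Lemma phi_dilate_zonotope I k : sliding phi ->
  phi (dilate k (partial_zonotope w I)) =
  \sum_(L : {set 'I_n} | L \subset I) half_open_value phi v L *+ (k ^ #|L|).
Proof.
move=> S; rewrite dilate_partial_zonotope.
rewrite (mobius_inversion
  (fun I => phi (partial_zonotope (fun i => lattice_pt R (v i *+ k)) I))).
by apply: eq_bigr => L _; rewrite -half_open_value_mulrn.
Qed.

Lemma hcoef_zonotope I k : sliding phi ->
  hcoef phi (partial_zonotope w I) k =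
  \sum_(L : {set 'I_n} | L \subset I)
     half_open_value phi v L *~ hvec (polytope_dim (partial_zonotope w I)) 'X^#|L| k.
Proof.
move=> S; rewrite /hcoef; under eq_bigr => j _ do
  rewrite phi_dilate_zonotope // mulrz_suml.
rewrite exchange_big /=; apply: eq_bigr => L _; rewrite /hvec mulrz_sumr.
apply: eq_bigr => j _; rewrite hornerXn mulrzA pmulrn.
by congr (_ *~ _ *~ _); rewrite -!natz natrX.
Qed.

(** By [hvec_Xn_top] the Möbius sum is the h-coefficient of degree |K| of the closed parallelepiped
    on [K], whose dimension is |K|. *)
Lemma mobius_half_open_value_ge0 K : sliding phi -> combinatorially_positive phi ->
  lin_indep w K -> 0 <= mobius (half_open_value phi v) K.
Proof.
move=> S [_ pos] iK.
have := pos _ (partial_zonotope_lattice R v K) #|K|.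
rewrite hcoef_zonotope // (polytope_dim_zonotope (subxx K) iK (dim_span_on _ _)).
congr (0 <= _); apply: eq_bigr => L LK.
by rewrite (hvec_Xn_top (subset_leq_card LK)).1 cardsD (setIidPr LK).
Qed.

End Assembly.

Theorem theorem5p12 (R : realType) (d n : nat) (v : 'I_n -> 'rV[int]_d)
    (G : porderZmodType) (phi : set 'rV[R]_d -> G)
    (v_inj : injective v)
    (v_span : spanning (fun i => lattice_pt R (v i)))
    (v_coloop_free : coloop_free (fun i => lattice_pt R (v i)))
    (phi_val : Zd_valuation phi)
    (phi_pos : combinatorially_positive phi) :
  let Z := zonotope (fun i => lattice_pt R (v i)) in
  (forall k : nat, (d < k)%N -> hcoef phi Z k = 0) /\
  alternatingly_increasing d (hcoef phi Z).
Proof.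
move=> Z; pose w i := lattice_pt R (v i).
have S := valuation_sliding phi_val.
have M := lin_indep_matroid v_span v_coloop_free.
have ZE : Z = partial_zonotope w (finset.setTfor 'I_n).
  rewrite /Z /zonotope /partial_zonotope; apply/seteqP; split=> x [l [l01 ->]];
  by exists l; split=> //; apply: eq_bigl => i; rewrite inE.
have dimZ : polytope_dim Z = d.
  have [K iK cK] := ind_basis M.
  by rewrite ZE (polytope_dim_zonotope (subsetT K) iK) ?cK // dim_rV_leq.
pose c := half_open_value phi v.
pose above (K : {set 'I_n}) : {poly int} :=
  \sum_(I : {set 'I_n} | lin_indep w I && (K \subset I)) 'X^#|I|.
(* Dependent I drop out, [mobius_inversion] expands the half-open values, and the two sums are
   exchanged; every K below an independent I is itself independent. *)
have hE k : hcoef phi Z k =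
    \sum_(K : {set 'I_n} | lin_indep w K) mobius c K *~ hvec d (above K) k.
  rewrite ZE hcoef_zonotope // -ZE dimZ.
  rewrite (bigID (lin_indep w)) /= [X in _ + X]big1 ?addr0; last first.
    move=> I /andP[_ /lin_dependentP[a ha aE]].
    by rewrite (half_open_value_dependent S ha aE) mul0rz.
  transitivity (\sum_(I : {set 'I_n} | lin_indep w I) \sum_(K : {set 'I_n} | K \subset I)
     mobius c K *~ hvec d 'X^#|I| k).
    apply: eq_big => [I|I _]; first by rewrite subsetT.
    by rewrite -mulrz_suml -mobius_inversion.
  rewrite (exchange_big_dep (lin_indep w)) /=; last first.
    by move=> I K iI KI; apply: lin_indepS iI.
  apply: eq_bigr => K iK; rewrite -mulrz_sumr; congr (_ *~ _).
  rewrite /above; elim/big_rec2: _ => [|I a b _ ->]; first by rewrite hvec0.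
  by rewrite hvecD.
have H K : lin_indep w K -> zigzag_increasing d (hvec d (above K)).
  by move=> iK; apply/alt_cone_hvec/indep_poly_above_cone.
have comp : order_compatible G by case: phi_pos.
have le i j : (forall K, lin_indep w K -> hvec d (above K) i <= hvec d (above K) j) ->
    hcoef phi Z i <= hcoef phi Z j.
  move=> Hij; rewrite !hE; elim/big_rec2: _ => // K x y iK xy.
  apply: (order_compatibleD comp) xy; apply: (order_compatible_mulrz comp).
    exact: mobius_half_open_value_ge0.
  exact: Hij.
split=> [k dk|j jd].
  by rewrite hE big1 // => K /H[_ /(_ _ dk) -> _ _]; rewrite mulr0z.
(* From an odd position the step goes from d - j/2 to j/2 + 1, from an even one from j/2 to d - j/2,
   with j/2 rounded down. *)
rewrite /zigzag oddS; case: (boolP (odd j)) => oj /=; apply: le => K /H[_ _ h1 h2].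
- have -> : (uphalf j) = j./2.+1 by lia.
  apply: h2; lia.
- have -> : (uphalf j) = j./2 by lia.
  apply: h1; lia.
Qed.
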